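(* Let $M$ be a hyperkähler manifold with twistor space $\mathcal{Z}$ and let $\alpha\in\mathscr{A}^{1,0}(\mathcal{Z})$ be a 1-form on $\mathcal{Z}$ of type $(1,0)$. The following statements are equivalent: (1) $\bar\partial_{\mathcal{Z}}\alpha\in\mathscr{A}^{1,1}_F(\mathcal{Z})$, that is, $\bar\partial_{\mathcal{Z}}\alpha$ is entirely supported on the fibers. (2) Locally, $\alpha$ is of the form $$\alpha=df(\zeta)\,I(\zeta)-i\,f(\zeta)\,\frac{d\zeta}{\zeta}$$ for some function $f=f(\zeta)\in\mathscr{A}^0(\mathcal{Z},\mathbb{C})$ satisfying $\bar\partial_{\mathbb{CP}^1}f=0$.
   Context: A hyperkähler manifold is a smooth manifold $M$ of real dimension $4m$ with three symplectic forms $\omega_1,\omega_2,\omega_3$ such that, viewing 2-forms as bundle maps $TM\to T^*M$, the endomorphisms $I_1=\omega_3^{-1}\omega_2$, $I_2=\omega_1^{-1}\omega_3$, $I_3=\omega_2^{-1}\omega_1$ of $TM$ satisfy $I_1^2=I_2^2=I_3^2=I_1I_2I_3=-1$; the metric $g$ is given by $\omega_i(X,Y)=g(X,I_iY)$. For $\mathbf{u}=(x_1,x_2,x_3)\in S^2$, $I(\mathbf{u})=x_1I_1+x_2I_2+x_3I_3$ is an integrable complex structure on $M$. Endomorphisms of $TM$ act on 1-forms from the right, $(\alpha I)(X)=\alpha(IX)$. Put $I_+=\tfrac12(I_1+iI_2)$, $I_0=I_3$, $I_-=-\tfrac12(I_1-iI_2)$ and $I(\zeta)=\frac{I_+}{\zeta}+I_0+\zeta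 I_-$, where $\zeta=-\frac{x_1+ix_2}{1+x_3}$ is the complex coordinate on $S^2\setminus\{(0,0,-1)\}\subset S^2\cong\mathbb{CP}^1$ (so $\zeta=0$ is $I_0$, $\zeta=\infty$ is $-I_0$). The twistor space is $\mathcal{Z}=M\times S^2$ with the (integrable) complex structure acting on $T_xM\oplus T_{\mathbf{u}}S^2$ as $I(\mathbf{u})\oplus I_{\mathbb{CP}^1}$; $p:\mathcal{Z}\to M$ and $\pi:\mathcal{Z}\to\mathbb{CP}^1$ are the projections. $\bar\partial_{\mathcal{Z}}$ is its Dolbeault operator. At a point $(x,\mathbf{u})$ the holomorphic cotangent space splits as $T^{*1,0}_{I(\mathbf{u})}M|_x\oplus T^{*1,0}_{\mathbf{u}}\mathbb{CP}^1$. $\mathscr{A}^{r,s}_F(\mathcal{Z})$ denotes the smooth $(r,s)$-forms on $\mathcal{Z}$ supported on the fibers of $\pi$, i.e. with no legs along $\mathbb{CP}^1$ in this product splitting (on the fiber over $\mathbf{u}$ they are $(r,s)$-forms on $M$ with respect to $I(\mathbf{u})$). $d$ is the exterior derivative in the $M$-directions and $\bar\partial_{\mathbb{CP}^1}$ the Dolbeault operator in the $\mathbb{CP}^1$-directions. Formulas are written over $\zeta\in\mathbb{C}^\times$, with the understanding that they are extended by analytic continuation to $\zeta=0,\infty$. *)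

(* Defs.v *)
From mathcomp Require Import all_boot all_order all_algebra.
From mathcomp Require Import all_classical all_reals all_analysis.
From mathcomp Require Export complex.
From mathcomp Require Import ring lra.

Set Implicit Arguments.
Unset Strict Implicit.
Unset Printing Implicit Defensive.

Import Order.TTheory GRing.Theory Num.Theory.
Import numFieldNormedType.Exports.

Local Open Scope classical_set_scope.
Local Open Scope ring_scope.
Local Open Scope complex_scope.

Section Smoothness.
Context {R : realType} {n : nat}.

(* [U] is meant to be open. *)
Fixpoint Ck_on (k : nat) (U : set 'rV[R]_n) (f : 'rV[R]_n -> R) : Prop :=
  if k is k'.+1 then
    (forall x, U x -> differentiable f x) /\
    (forall j : 'I_n, Ck_on k' U (fun x => 'D_(delta_mx 0 j) f x))
  else forall x, U x -> {for x, continuous f}.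

Definition smooth_on (U : set 'rV[R]_n) (f : 'rV[R]_n -> R) : Prop :=
  forall k, Ck_on k U f.

End Smoothness.

(* [cinv] only matters on the image of [cdom] by [cmap]. *)
Record chart (R : realType) (X : topologicalType) (n : nat) := Chart {
  cdom : set X;
  cmap : X -> 'rV[R]_n;
  cinv : 'rV[R]_n -> X }.

Record atlas (R : realType) (X : topologicalType) (n : nat) := Atlas {
  aidx : Type;
  achart :> aidx -> chart R X n }.

Section Manifolds.
Context {R : realType} {X : topologicalType} {n : nat}.
Implicit Types (c : chart R X n) (A : atlas R X n).

Definition is_chart c : Prop :=
  [/\ open (cdom c),
      open (cmap c @` cdom c),
      (forall p, cdom c p -> cinv c (cmap c p) = p),
      (forall p, cdom c p -> {for p, continuous (cmap c)}) &
      (forall v, (cmap c @` cdom c) v -> {for v, continuous (cinv c)})].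

Definition transition c c' : 'rV[R]_n -> 'rV[R]_n := cmap c' \o cinv c.

Definition smooth_manifold A : Prop :=
  [/\ hausdorff_space X,
      @second_countable X,
      (forall a, is_chart (A a)),
      (forall p, exists a, cdom (A a) p) &
      (forall a b (k : 'I_n),
         smooth_on (cmap (A a) @` (cdom (A a) `&` cdom (A b)))
                   (fun v => transition (A a) (A b) v 0 k))].

(* The transpose turns the library's Jacobian, which multiplies row vectors,
   into the matrix (d y_l / d x_k)_(l, k) acting on columns of tangent
   components. *)
Definition jac c c' (p : X) : 'M[R]_n :=
  (jacobian (transition c c') (cmap c p))^T.

Definition pder c (h : X -> R) (j : 'I_n) (p : X) : R :=
  'D_(delta_mx 0 j) (h \o cinv c) (cmap c p).

Definition pderC c (f : X -> R[i]) (j : 'I_n) (p : X) : R[i] :=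
  pder c (fun q => complex.Re (f q)) j p +i*
  pder c (fun q => complex.Im (f q)) j p.

Definition dC c (f : X -> R[i]) (p : X) : 'rV[R[i]]_n :=
  \row_j pderC c f j p.

Definition smooth_fun A (U : set X) (h : X -> R) : Prop :=
  forall a, smooth_on (cmap (A a) @` (cdom (A a) `&` U)) (h \o cinv (A a)).

Definition smooth_funC A (U : set X) (f : X -> R[i]) : Prop :=
  smooth_fun A U (fun p => complex.Re (f p)) /\
  smooth_fun A U (fun p => complex.Im (f p)).

(* Tensor fields are families of components, one for each chart of the atlas.
   Tangent vectors are columns, 1-forms are rows (so that the right action of
   an endomorphism [J] on a 1-form [a] is [a *m J]), and a bilinear form [W]
   is evaluated as X^T W Y. *)
Definition smooth_1form A (al : aidx A -> X -> 'rV[R[i]]_n) : Prop :=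
  (forall a j, smooth_fun A (cdom (A a)) (fun p => complex.Re (al a p 0 j)) /\
               smooth_fun A (cdom (A a)) (fun p => complex.Im (al a p 0 j))) /\
  (forall a b p, cdom (A a) p -> cdom (A b) p ->
     al a p = al b p *m map_mx (real_complex R) (jac (A a) (A b) p)).

Definition smooth_bilinear A (W : aidx A -> X -> 'M[R]_n) : Prop :=
  (forall a j k, smooth_fun A (cdom (A a)) (fun p => W a p j k)) /\
  (forall a b p, cdom (A a) p -> cdom (A b) p ->
     W a p = (jac (A a) (A b) p)^T *m W b p *m jac (A a) (A b) p).

Definition closed_2form A (W : aidx A -> X -> 'M[R]_n) : Prop :=
  forall a p, cdom (A a) p -> forall i j k,
    pder (A a) (fun q => W a q j k) i p + pder (A a) (fun q => W a q k i) j p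
    + pder (A a) (fun q => W a q i j) k p = 0.

Definition symplectic_form A (W : aidx A -> X -> 'M[R]_n) : Prop :=
  [/\ smooth_bilinear W,
      (forall a p, cdom (A a) p -> (W a p)^T = - W a p),
      (forall a p, cdom (A a) p -> W a p \in unitmx) &
      closed_2form W].

Definition riemannian_metric A (g : aidx A -> X -> 'M[R]_n) : Prop :=
  [/\ smooth_bilinear g,
      (forall a p, cdom (A a) p -> (g a p)^T = g a p) &
      (forall a p, cdom (A a) p -> forall v : 'cV[R]_n, v != 0 ->
         0 < (v^T *m g a p *m v) 0 0)].

Definition d1 c (al : X -> 'rV[R[i]]_n) (p : X) : 'M[R[i]]_n :=
  \matrix_(j, k) (pderC c (fun q => al q 0 k) j p
                  - pderC c (fun q => al q 0 j) k p).

End Manifolds.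

Section Types.
Context {R : realType} {n : nat}.
Implicit Types (J : 'M[R]_n) (be : 'rV[R[i]]_n) (W : 'M[R[i]]_n).

(* Projectors of the complexified tangent space onto the +i and -i eigenspaces
   of the almost complex structure J. *)
Definition proj10 J : 'M[R[i]]_n :=
  2^-1 *: (1%:M - 'i%C *: map_mx (real_complex R) J).
Definition proj01 J : 'M[R[i]]_n :=
  2^-1 *: (1%:M + 'i%C *: map_mx (real_complex R) J).

Definition part01 J be : 'rV[R[i]]_n := be *m proj01 J.
Definition type10 J be : Prop := part01 J be = 0.

Definition part11 J W : 'M[R[i]]_n :=
  (proj10 J)^T *m W *m proj01 J + (proj01 J)^T *m W *m proj10 J.
Definition type11 J W : Prop :=
  (proj10 J)^T *m W *m proj10 J = 0 /\ (proj01 J)^T *m W *m proj01 J = 0.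

End Types.

Section Sphere.
Context {R : realType}.

(* Triples are left-nested: x = ((x1, x2), x3). *)
Definition sphere : set (R * R * R) :=
  [set x | x.1.1 ^+ 2 + x.1.2 ^+ 2 + x.2 ^+ 2 = 1].

(* The unit sphere as a type, with the subspace topology. *)
Definition S2 : topologicalType := set_type sphere.

Definition sx1 (u : S2) : R := (\val u).1.1.
Definition sx2 (u : S2) : R := (\val u).1.2.
Definition sx3 (u : S2) : R := (\val u).2.

(* Defined for x3 != -1. *)
Definition zeta (u : S2) : R[i] :=
  - ((sx1 u / (1 + sx3 u)) +i* (sx2 u / (1 + sx3 u))).

(* 1 / zeta, defined for x3 != 1. *)
Definition zeta_inv (u : S2) : R[i] :=
  - ((sx1 u / (1 - sx3 u)) -i* (sx2 u / (1 - sx3 u))).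

Definition row_of_complex (z : R[i]) : 'rV[R]_2 :=
  \row_j (if j == 0 then complex.Re z else complex.Im z).

Lemma stereo_subproof (s a b : R) : s ^+ 2 = 1 ->
  (- 2 * a / (1 + a ^+ 2 + b ^+ 2),
   - 2 * b / (1 + a ^+ 2 + b ^+ 2),
   s * (1 - a ^+ 2 - b ^+ 2) / (1 + a ^+ 2 + b ^+ 2)) \in sphere.
Proof.
move=> s1; apply/mem_set; rewrite /sphere /=.
have r_neq0 : 1 + a ^+ 2 + b ^+ 2 != 0.
  by apply: lt0r_neq0; have := sqr_ge0 a; have := sqr_ge0 b; lra.
rewrite !exprMn s1 exprVn; field.
by rewrite r_neq0.
Qed.

Definition zeta_invmap (v : 'rV[R]_2) : S2 :=
  SigSub (@stereo_subproof 1 (v 0 0) (v 0 1) (expr1n _ 2)).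

Definition zeta_inv_invmap (v : 'rV[R]_2) : S2 :=
  SigSub (@stereo_subproof (-1) (v 0 0) (- v 0 1) (etrans (sqrrN 1) (expr1n _ 2))).

Definition S2_atlas : atlas R S2 2 :=
  Atlas (fun s : bool =>
    if s then
      Chart [set u : S2 | sx3 u != -1]
            (fun u => row_of_complex (zeta u)) zeta_invmap
    else
      Chart [set u : S2 | sx3 u != 1]
            (fun u => row_of_complex (zeta_inv u)) zeta_inv_invmap).

(* Multiplication by i; it has this same matrix in both (holomorphic) charts
   of S2_atlas. *)
Definition J_CP1 : 'M[R]_2 :=
  \matrix_(j, k) (if (j == 0) && (k == 1) then -1
                  else if (j == 1) && (k == 0) then 1 else 0).

Definition zeta_Cstar : set S2 := [set u : S2 | sx3 u != -1 /\ zeta u != 0].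

End Sphere.

Definition prod_atlas (R : realType) (X Y : topologicalType) (n k : nat)
    (A : atlas R X n) (B : atlas R Y k) : atlas R (X * Y)%type (n + k) :=
  Atlas (fun ab : aidx A * aidx B =>
    Chart (cdom (A ab.1) `*` cdom (B ab.2))
          (fun z => row_mx (cmap (A ab.1) z.1) (cmap (B ab.2) z.2))
          (fun v => (cinv (A ab.1) (lsubmx v), cinv (B ab.2) (rsubmx v)))).

(* A 2-form W viewed as a bundle map sends Y to W(-, Y), i.e. acts as the matrix
   W on columns; the other convention Y |-> W(Y, -) changes the sign of every W
   and yields the same I1, I2, I3.  The last field says
   om_i(X, Y) = metric(X, I_i Y). *)
Record hyperkahler (R : realType) (m : nat) (M : topologicalType)
    (A : atlas R M (4 * m)) := Hyperkahler {
  om1 : aidx A -> M -> 'M[R]_(4 * m);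
  om2 : aidx A -> M -> 'M[R]_(4 * m);
  om3 : aidx A -> M -> 'M[R]_(4 * m);
  I1 := fun a p => invmx (om3 a p) *m om2 a p;
  I2 := fun a p => invmx (om1 a p) *m om3 a p;
  I3 := fun a p => invmx (om2 a p) *m om1 a p;
  metric : aidx A -> M -> 'M[R]_(4 * m);
  om1_symplectic : symplectic_form om1;
  om2_symplectic : symplectic_form om2;
  om3_symplectic : symplectic_form om3;
  quaternionic : forall a p, cdom (A a) p ->
    [/\ I1 a p *m I1 a p = - 1%:M,
        I2 a p *m I2 a p = - 1%:M,
        I3 a p *m I3 a p = - 1%:M &
        I1 a p *m I2 a p *m I3 a p = - 1%:M];
  metric_riemannian : riemannian_metric metric;
  metric_om : forall a p, cdom (A a) p ->
    [/\ om1 a p = metric a p *m I1 a p,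
        om2 a p = metric a p *m I2 a p &
        om3 a p = metric a p *m I3 a p] }.

Section Twistor.
Context {R : realType} {m : nat} {M : topologicalType}.
Context {A : atlas R M (4 * m)}.
Implicit Types (h : hyperkahler A) (z : M * @S2 R).

Definition I_sphere h (a : aidx A) (p : M) (u : S2) : 'M[R]_(4 * m) :=
  sx1 u *: I1 h a p + sx2 u *: I2 h a p + sx3 u *: I3 h a p.

Definition I_plus h a p : 'M[R[i]]_(4 * m) :=
  2^-1 *: (map_mx (real_complex R) (I1 h a p)
           + 'i%C *: map_mx (real_complex R) (I2 h a p)).
Definition I_zero h a p : 'M[R[i]]_(4 * m) :=
  map_mx (real_complex R) (I3 h a p).
Definition I_minus h a p : 'M[R[i]]_(4 * m) :=
  - (2^-1 *: (map_mx (real_complex R) (I1 h a p)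
              - 'i%C *: map_mx (real_complex R) (I2 h a p))).

Definition I_zeta h a p (x : R[i]) : 'M[R[i]]_(4 * m) :=
  x^-1 *: I_plus h a p + I_zero h a p + x *: I_minus h a p.

Definition twistor_atlas : atlas R (M * @S2 R)%type (4 * m + 2) :=
  prod_atlas A (@S2_atlas R).

Definition twistor_J h (a : aidx twistor_atlas) z : 'M[R]_(4 * m + 2) :=
  block_mx (I_sphere h a.1 z.1 z.2) 0 0 J_CP1.

Definition form10 h (al : aidx twistor_atlas -> M * @S2 R ->
    'rV[R[i]]_(4 * m + 2)) : Prop :=
  smooth_1form al /\
  forall a z, cdom (twistor_atlas a) z -> type10 (twistor_J h a z) (al a z).

(* The Dolbeault operator on (1,0)-forms: the (1,1)-component of d. *)
Definition dbar h (al : aidx twistor_atlas -> M * @S2 R ->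
    'rV[R[i]]_(4 * m + 2)) (a : aidx twistor_atlas) z :
    'M[R[i]]_(4 * m + 2) :=
  part11 (twistor_J h a z) (d1 (twistor_atlas a) (al a) z).

(* Type (1,1) and vanishing whenever one argument is tangent to the sphere
   factor.  It is applied to [dbar h al] only, whose smoothness and tensoriality
   are inherited from [al]. *)
Definition fiber_form11 h (W : aidx twistor_atlas -> M * @S2 R ->
    'M[R[i]]_(4 * m + 2)) : Prop :=
  forall a z, cdom (twistor_atlas a) z ->
    [/\ type11 (twistor_J h a z) (W a z),
        ursubmx (W a z) = 0, dlsubmx (W a z) = 0 & drsubmx (W a z) = 0].

Definition d_M (f : M * @S2 R -> R[i]) (a : aidx twistor_atlas) z :
    'rV[R[i]]_(4 * m) :=
  lsubmx (dC (twistor_atlas a) f z).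

Definition dbar_CP1 (f : M * @S2 R -> R[i]) (a : aidx twistor_atlas) z :
    'rV[R[i]]_2 :=
  part01 J_CP1 (rsubmx (dC (twistor_atlas a) f z)).

Definition dzeta (a : aidx twistor_atlas) z : 'rV[R[i]]_(4 * m + 2) :=
  dC (twistor_atlas a) (fun y => zeta y.2) z.

End Twistor.

Arguments twistor_atlas {R m M} A.

(* Main.v *)
Require Import Defs.
From mathcomp Require Import all_boot all_order all_algebra.
From mathcomp Require Import all_classical all_reals all_analysis.
From mathcomp Require Import ring lra.
Import Order.TTheory GRing.Theory Num.Theory numFieldNormedType.Exports.
Local Open Scope classical_set_scope.
Local Open Scope ring_scope.
Local Open Scope complex_scope.

(** In a chart write alpha = a + b dzeta, with a the part along the fibre and
    b the coefficient along the sphere.  Everything rests on one family of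
    endomorphisms of the complexified tangent space of M, the polynomial
    N(zeta) = 2 zeta I(zeta) = 2 (I_+ + zeta I_0 + zeta^2 I_-), which squares
    to zero.  At the point u of the sphere with coordinate zeta one has
    2 I(u) = N'(zeta) + mu N(zeta) for a scalar mu ([unit_quat_null_quat]).
    Hence a 1-form a is of type (1,0) for I(u) exactly when a N(zeta) = 0
    ([eigenform_null_quat]), and then a N'(zeta) = 2i a.  The gain is that
    N(zeta) depends holomorphically on zeta, which I(u) does not.

    Differentiating a N = 0 along the sphere therefore gives (dbar a) N = 0 and
    (d/dzeta a) N = - 2i a.  Apart from the purely vertical part, the
    (1,1)-component of d alpha consists of dbar b, of the (1,0)-part of dbar a
    and of the (0,1)-part of d_M b - d/dzeta a.  By the criterion above, dbar a
    has only a (1,0)-part, and the last term vanishes exactly when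
    (d_M b) N = - 2i a.  So dbar alpha is supported on the fibres exactly when

      dbar b = 0,      2 a = i (d_M b) N,      dbar a = 0

    ([fiber11_pointwise]).  With f = i zeta b the term -i f dzeta/zeta is
    b dzeta, the first equation says that f is holomorphic along the sphere, and
    the second one is a = df I(zeta).  The first two equations are thus the
    second statement of the theorem, and they imply the third one, because
    d_M and dbar commute and N is holomorphic.

    Near zeta = infinity the same computation applies to the coordinate 1/zeta
    and the triple (I1, - I2, - I3); a sign s distinguishes the two charts and
    f becomes i s zeta_s b.  That number is, up to a constant, the pairing of
    alpha with the rotation field zeta d/dzeta, so it does not depend on the
    chart ([sphere_component_law]) and f can be taken globally defined.
    Conversely, the formula for alpha constrains it only over zeta in
    C^x; the equations extend to the two missing fibres by continuity along the
    sphere ([potential_equations]). *)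

Set Implicit Arguments.
Unset Strict Implicit.
Unset Printing Implicit Defensive.

(** * Symmetry of second derivatives *)

Lemma is_derive_line (R : realType) (V : normedModType R) (f : V -> R)
    (p u : V) (s : R) :
  differentiable f (s *: u + p) ->
  is_derive s 1 (fun t : R => f (t *: u + p)) ('D_u f (s *: u + p)).
Proof.
move=> /(@diff_derivable _ _ _ f _ u) df.
have E : (fun h : R => h^-1 *: ((f \o shift (s *: u + p)) (h *: u) -
                            f (s *: u + p))) =
  (fun h : R => h^-1 *: (((fun t : R => f (t *: u + p)) \o shift s) (h *: 1) -
                            f (s *: u + p))).
  by apply/funext => h /=; rewrite scalerDl addrA [h *: 1]mulr1.
by split; [rewrite /derivable -E|rewrite /derive -E].
Qed.

(** The mean value theorem in the direction u, applied to the difference of f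
    between two parallel segments, and then in the direction w. *)
Lemma second_difference (R : realType) (V : normedModType R) (f : V -> R)
    (x u w : V) (h : R) : 0 < h ->
  (forall s t, 0 <= s <= h -> 0 <= t <= h ->
     differentiable f (s *: u + (t *: w + x)) /\
     differentiable ('D_u f) (s *: u + (t *: w + x))) ->
  exists s t, [/\ 0 <= s <= h, 0 <= t <= h &
   f (h *: u + (h *: w + x)) - f (h *: u + x) - f (h *: w + x) + f x
   = h * h * 'D_w ('D_u f) (s *: u + (t *: w + x))].
Proof.
move=> h0 df.
have hh : 0 <= h <= h by rewrite ltW //=.
have h00 : 0 <= (0 : R) <= h by rewrite lexx ltW.
have df0 s : 0 <= s <= h -> differentiable f (s *: u + x).
  by move=> sh; have [] := df s 0 sh h00; rewrite scale0r add0r.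
pose phi (s : R) := f (s *: u + (h *: w + x)) - f (s *: u + x).
pose dphi (s : R) := 'D_u f (s *: u + (h *: w + x)) - 'D_u f (s *: u + x).
have dphiP s : 0 <= s <= h -> is_derive s 1 phi (dphi s).
  move=> sh; apply: is_deriveB.
    by apply: is_derive_line; have [] := df s h sh hh.
  by apply: is_derive_line; exact: df0.
have [s] : exists2 s, s \in `]0, h[%R & phi h - phi 0 = dphi s * (h - 0).
  apply: (MVT h0).
    by move=> s; rewrite in_itv /= => /andP[s0 sh]; apply: dphiP; rewrite !ltW.
  apply: derivable_within_continuous => s; rewrite in_itv /= => sh.
  by have [] := dphiP s sh.
rewrite in_itv /= => /andP[s0 sh] Ephi.
have sh' : 0 <= s <= h by rewrite !ltW.
pose psi (t : R) := 'D_u f (t *: w + (s *: u + x)).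
pose dpsi (t : R) := 'D_w ('D_u f) (t *: w + (s *: u + x)).
have psiP t : 0 <= t <= h -> is_derive t 1 psi (dpsi t).
  move=> th; apply: is_derive_line.
  by have [_] := df s t sh' th; rewrite addrCA.
have [t] : exists2 t, t \in `]0, h[%R & psi h - psi 0 = dpsi t * (h - 0).
  apply: (MVT h0).
    by move=> t; rewrite in_itv /= => /andP[t0 th]; apply: psiP; rewrite !ltW.
  apply: derivable_within_continuous => t; rewrite in_itv /= => th.
  by have [] := psiP t th.
rewrite in_itv /= => /andP[t0 th] Epsi.
exists s, t; split => //; first by rewrite !ltW.
rewrite [s *: u + _]addrCA.
move: Epsi Ephi; rewrite /psi /dpsi /phi /dphi !scale0r !add0r subr0.
rewrite [h *: w + (s *: u + x)]addrCA => -> E.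
transitivity (f (h *: u + (h *: w + x)) - f (h *: u + x)
              - (f (h *: w + x) - f x)); first by rewrite opprB [RHS]addrA [RHS]addrAC.
by rewrite E mulrC mulrA mulrAC.
Qed.

(** The second difference of f over a small parallelogram is symmetric in its
    two sides, and it is close to both mixed derivatives. *)
Lemma derive_comm (R : realType) (V : normedModType R) (f : V -> R)
    (x u w : V) :
  (\forall y \near x, differentiable f y) ->
  (\forall y \near x, differentiable ('D_u f) y) ->
  (\forall y \near x, differentiable ('D_w f) y) ->
  {for x, continuous ('D_w ('D_u f))} ->
  {for x, continuous ('D_u ('D_w f))} ->
  'D_w ('D_u f) x = 'D_u ('D_w f) x.
Proof.
move=> df dfu dfw cwu cuw; apply/eqP; rewrite -subr_eq0 -normr_le0.
apply/ler_addgt0Pl => e e0; rewrite addr0.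
have e20 : 0 < e / 2 by rewrite divr_gt0.
have : \forall y \near x, [/\ differentiable f y, differentiable ('D_u f) y,
   differentiable ('D_w f) y,
   `|'D_w ('D_u f) x - 'D_w ('D_u f) y| < e / 2 &
   `|'D_u ('D_w f) x - 'D_u ('D_w f) y| < e / 2].
  move/cvgrPdist_lt : cwu => /(_ _ e20) cwu.
  move/cvgrPdist_lt : cuw => /(_ _ e20) cuw.
  apply: filterS (filterI (filterI df (filterI dfu dfw)) (filterI cwu cuw)).
  move=> y [[f1 [f2 f3]] [f4 f5]]; exact: (And5 f1 f2 f3 f4 f5).
move=> /nbhs_ballP[d /= d0 dP].
have nuw : 0 < `|u| + `|w| + 1 by rewrite ltr_wpDl // addr_ge0.
(* the parallelogram with sides h u and h w stays in the ball of radius d *)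
pose h := d / 2 / (`|u| + `|w| + 1).
have h0 : 0 < h by rewrite !divr_gt0.
have inball s t : 0 <= s <= h -> 0 <= t <= h ->
    ball x d (s *: u + (t *: w + x)).
  move=> /andP[s0 sh] /andP[t0 th]; rewrite -ball_normE /ball_ /=.
  rewrite distrC addrA addrK (le_lt_trans (ler_normD _ _)) // !normrZ.
  rewrite (ger0_norm s0) (ger0_norm t0).
  apply: (@le_lt_trans _ _ (h * (`|u| + `|w| + 1))).
    rewrite mulrDr mulr1 mulrDr; apply: ler_wpDr; first exact: ltW.
    by apply: lerD; apply: ler_wpM2r.
  by rewrite /h divfK ?gt_eqF // ltr_pdivrMr // ltr_pMr // ltr1n.
have [s1 [t1 [s1h t1h E1]]] : exists s t, [/\ 0 <= s <= h, 0 <= t <= h &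
   f (h *: u + (h *: w + x)) - f (h *: u + x) - f (h *: w + x) + f x
   = h * h * 'D_w ('D_u f) (s *: u + (t *: w + x))].
  apply: second_difference => // s t sh th.
  by have [] := dP _ (inball s t sh th).
have [s2 [t2 [s2h t2h E2]]] : exists s t, [/\ 0 <= s <= h, 0 <= t <= h &
   f (h *: w + (h *: u + x)) - f (h *: w + x) - f (h *: u + x) + f x
   = h * h * 'D_u ('D_w f) (s *: w + (t *: u + x))].
  apply: second_difference => // s t sh th.
  have := inball t s th sh; rewrite addrCA.
  by move/dP=> [].
have E : 'D_w ('D_u f) (s1 *: u + (t1 *: w + x)) =
         'D_u ('D_w f) (s2 *: w + (t2 *: u + x)).
  have hh : h * h != 0 by rewrite mulf_neq0 // gt_eqF.
  apply: (mulfI hh); rewrite -E1 -E2 [h *: w + (h *: u + x)]addrCA.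
  ring.
have [_ _ _ P1 _] := dP _ (inball _ _ s1h t1h).
have := inball _ _ t2h s2h; rewrite addrCA => /dP[_ _ _ _ P2].
rewrite -(subrKA ('D_w ('D_u f) (s1 *: u + (t1 *: w + x)))).
apply: (le_trans (ler_normD _ _)); rewrite [e]splitr; apply: lerD.
  exact: (ltW P1).
rewrite E distrC; exact: (ltW P2).
Qed.

(** * Partial derivatives of complex-valued functions *)

Lemma cReD (R : realType) (z w : R[i]) :
  complex.Re (z + w) = complex.Re z + complex.Re w.
Proof. by case: z; case: w. Qed.
Lemma cImD (R : realType) (z w : R[i]) :
  complex.Im (z + w) = complex.Im z + complex.Im w.
Proof. by case: z; case: w. Qed.
Lemma cReM (R : realType) (z w : R[i]) : complex.Re (z * w) =
  complex.Re z * complex.Re w - complex.Im z * complex.Im w.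
Proof. by case: z; case: w. Qed.
Lemma cImM (R : realType) (z w : R[i]) : complex.Im (z * w) =
  complex.Re z * complex.Im w + complex.Im z * complex.Re w.
Proof. by case: z; case: w. Qed.

Definition cdiff (R : realType) (N : nat) (F : 'rV[R]_N -> R[i])
    (v : 'rV[R]_N) : Prop :=
  differentiable (fun y => complex.Re (F y)) v /\
  differentiable (fun y => complex.Im (F y)) v.

Definition cD (R : realType) (N : nat) (j : 'I_N) (F : 'rV[R]_N -> R[i])
    (v : 'rV[R]_N) : R[i] :=
  'D_(delta_mx 0 j) (fun y => complex.Re (F y)) v +i*
  'D_(delta_mx 0 j) (fun y => complex.Im (F y)) v.

Lemma cdiff_cst (R : realType) (N : nat) (c : R[i]) (v : 'rV[R]_N) :
  cdiff (fun=> c) v.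
Proof. by split; exact: differentiable_cst. Qed.

Lemma cdiffD (R : realType) (N : nat) (F G : 'rV[R]_N -> R[i]) v :
  cdiff F v -> cdiff G v -> cdiff (fun y => F y + G y) v.
Proof.
move=> [Fr Fi] [Gr Gi]; split.
- under eq_fun do rewrite cReD; exact: differentiableD.
- under eq_fun do rewrite cImD; exact: differentiableD.
Qed.

Lemma cdiffM (R : realType) (N : nat) (F G : 'rV[R]_N -> R[i]) v :
  cdiff F v -> cdiff G v -> cdiff (fun y => F y * G y) v.
Proof.
move=> [Fr Fi] [Gr Gi]; split.
- under eq_fun do rewrite cReM.
  apply: differentiableB; [exact: differentiableM Fr Gr|
                           exact: differentiableM Fi Gi].
- under eq_fun do rewrite cImM.
  apply: differentiableD; [exact: differentiableM Fr Gi|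
                           exact: differentiableM Fi Gr].
Qed.

Lemma cdiff_sum (R : realType) (N : nat) (I : Type) (r : seq I)
    (F : I -> 'rV[R]_N -> R[i]) v :
  (forall i, cdiff (F i) v) -> cdiff (fun y => \sum_(i <- r) F i y) v.
Proof.
move=> dF; elim: r => [|i r IH].
  by under eq_fun do rewrite big_nil; exact: cdiff_cst.
by under eq_fun do rewrite big_cons; exact: cdiffD.
Qed.

Lemma cD_cst (R : realType) (N : nat) (c : R[i]) j (v : 'rV[R]_N) :
  cD j (fun=> c) v = 0.
Proof. by rewrite /cD !derive_cst. Qed.

Lemma cDD (R : realType) (N : nat) (F G : 'rV[R]_N -> R[i]) j v :
  cdiff F v -> cdiff G v -> cD j (fun y => F y + G y) v = cD j F v + cD j G v.
Proof.
move=> [dFr dFi] [dGr dGi].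
have Fr := @diff_derivable _ _ _ _ _ (delta_mx 0 j) dFr.
have Fi := @diff_derivable _ _ _ _ _ (delta_mx 0 j) dFi.
have Gr := @diff_derivable _ _ _ _ _ (delta_mx 0 j) dGr.
have Gi := @diff_derivable _ _ _ _ _ (delta_mx 0 j) dGi.
rewrite /cD.
have -> : (fun y => complex.Re (F y + G y)) =
  (fun y => complex.Re (F y)) + (fun y => complex.Re (G y)).
  by apply/funext => y; rewrite cReD.
have -> : (fun y => complex.Im (F y + G y)) =
  (fun y => complex.Im (F y)) + (fun y => complex.Im (G y)).
  by apply/funext => y; rewrite cImD.
by rewrite (deriveD Fr Gr) (deriveD Fi Gi).
Qed.

Lemma cDM (R : realType) (N : nat) (F G : 'rV[R]_N -> R[i]) j v :
  cdiff F v -> cdiff G v ->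
  cD j (fun y => F y * G y) v = cD j F v * G v + F v * cD j G v.
Proof.
move=> [dFr dFi] [dGr dGi].
have Fr := @diff_derivable _ _ _ _ _ (delta_mx 0 j) dFr.
have Fi := @diff_derivable _ _ _ _ _ (delta_mx 0 j) dFi.
have Gr := @diff_derivable _ _ _ _ _ (delta_mx 0 j) dGr.
have Gi := @diff_derivable _ _ _ _ _ (delta_mx 0 j) dGi.
rewrite /cD.
have -> : (fun y => complex.Re (F y * G y)) =
  (fun y => complex.Re (F y)) * (fun y => complex.Re (G y)) -
  (fun y => complex.Im (F y)) * (fun y => complex.Im (G y)).
  by apply/funext => y; rewrite cReM.
have -> : (fun y => complex.Im (F y * G y)) =
  (fun y => complex.Re (F y)) * (fun y => complex.Im (G y)) +
  (fun y => complex.Im (F y)) * (fun y => complex.Re (G y)).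
  by apply/funext => y; rewrite cImM.
rewrite deriveB; [|exact: derivableM Fr Gr|exact: derivableM Fi Gi].
rewrite deriveD; [|exact: derivableM Fr Gi|exact: derivableM Fi Gr].
rewrite (deriveM Fr Gr) (deriveM Fi Gi) (deriveM Fr Gi) (deriveM Fi Gr).
have sc (x y : R) : x *: y = x * y by [].
rewrite !sc.
case: (F v) => a b; case: (G v) => c d.
apply/eqP; rewrite eq_complex /=.
by apply/andP; split; apply/eqP; ring.
Qed.

Lemma cD_sum (R : realType) (N : nat) (I : Type) (r : seq I)
    (F : I -> 'rV[R]_N -> R[i]) j v :
  (forall i, cdiff (F i) v) ->
  cD j (fun y => \sum_(i <- r) F i y) v = \sum_(i <- r) cD j (F i) v.
Proof.
move=> dF; elim: r => [|i r IH].
  by rewrite big_nil; under eq_fun do rewrite big_nil; exact: cD_cst.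
rewrite big_cons -IH.
have -> : (fun y => \sum_(k <- i :: r) F k y) =
  (fun y => F i y + \sum_(k <- r) F k y).
  by apply/funext => y; rewrite big_cons.
by apply: cDD; [exact: dF|exact: cdiff_sum].
Qed.

Lemma cD_near (R : realType) (N : nat) (F G : 'rV[R]_N -> R[i]) j v :
  (\forall y \near v, F y = G y) -> cD j F v = cD j G v.
Proof.
move=> FG; rewrite /cD; congr (_ +i* _); apply: near_eq_derive.
  by apply: filterS FG => y ->.
by apply: filterS FG => y ->.
Qed.

Lemma derive_line (R : realType) (V : normedModType R) (f : V -> R) (u v : V) :
  'D_u f v = 'D_1 (fun t : R => f (t *: u + v)) 0.
Proof.
have E : (fun h : R => h^-1 *: ((f \o shift v) (h *: u) - f v)) =
  (fun h : R => h^-1 *: (((fun t : R => f (t *: u + v)) \o shift 0) (h *: 1) -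
                            f (0 *: u + v))).
  by apply/funext => h /=; rewrite addr0 scale0r add0r [h *: 1]mulr1.
by rewrite /derive E.
Qed.

(** A partial derivative sees only one line; so identities that only hold
    on one fibre of the projection to M can be differentiated along it. *)
Lemma cD_line (R : realType) (N : nat) (F G : 'rV[R]_N -> R[i]) j v :
  (\forall t \near (0 : R),
     F (t *: delta_mx 0 j + v) = G (t *: delta_mx 0 j + v)) ->
  cD j F v = cD j G v.
Proof.
move=> FG.
have E (g : R[i] -> R) : 'D_(delta_mx 0 j) (fun y => g (F y)) v =
                         'D_(delta_mx 0 j) (fun y => g (G y)) v.
  rewrite [LHS]derive_line [RHS]derive_line; apply: near_eq_derive.
  by apply: filterS FG => t ->.
by rewrite /cD (E (@complex.Re R)) (E (@complex.Im R)).
Qed.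

Lemma cdiff_continuous (R : realType) (N : nat) (F : 'rV[R]_N -> R[i]) v :
  cdiff F v ->
  {for v, continuous (fun y => complex.Re (F y))} /\
  {for v, continuous (fun y => complex.Im (F y))}.
Proof.
by move=> [Fr Fi]; split; exact: differentiable_continuous.
Qed.

Lemma line_cvg (R : realType) (V : normedModType R) (v w : V) :
  (fun t : R => t *: w + v) @ (0 : R) --> v.
Proof.
have c : {for 0, continuous (fun t : R => t *: w + v)}.
  by apply: continuousD; [exact: scalel_continuous|exact: cvg_cst].
by move: c; rewrite /prop_for /continuous_at scale0r add0r.
Qed.

(** Used to recover the equations over the poles of the sphere from the
    neighbouring points. *)
Lemma cdiff_eq0_punctured_line (R : realType) (N : nat) (F : 'rV[R]_N -> R[i])
    v w :
  cdiff F v -> (\forall t \near (0 : R)^', F (t *: w + v) = 0) -> F v = 0.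
Proof.
move=> /cdiff_continuous[Fr Fi] F0.
have line : (fun t : R => t *: w + v) @ 0^' --> v.
  by apply: cvg_trans (@line_cvg _ _ v w); apply: cvg_app; exact: cvg_within.
have limit0 (f : 'rV[R]_N -> R) : {for v, continuous f} ->
    (\forall t \near (0 : R)^', f (t *: w + v) = 0) -> f v = 0.
  move=> cf f0; have fl := cvg_comp _ _ line cf.
  have f00 : (f \o (fun t : R => t *: w + v)) @ 0^' --> (0 : R).
    by apply: cvg_near_cst; exact: f0.
  exact: (cvg_unique _ fl f00).
have r0 : complex.Re (F v) = 0.
  by apply: (limit0 (fun y => complex.Re (F y))) => //; apply: filterS F0 => t ->.
have i0 : complex.Im (F v) = 0.
  by apply: (limit0 (fun y => complex.Im (F y))) => //; apply: filterS F0 => t ->.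
by move: r0 i0; case: (F v) => a b /= -> ->.
Qed.

(** * Smooth complex functions on an open set *)

(** Both functions have the same first order expansion at x. *)
Lemma near_eq_differentiable (R : realType) (V W : normedModType R)
    (f g : V -> W) (x : V) :
  (\forall y \near x, f y = g y) -> differentiable f x -> differentiable g x.
Proof.
move=> fg df.
have fgx : f x = g x by exact: nbhs_singleton fg.
have dg : g \o shift x = cst (g x) + 'd f x +o_ 0 id.
  have := diff_locally df => /eqaddoP H.
  apply/eqaddoP => e e0; have He := H e e0.
  have fg0 : \forall h \near (0 : V), f (h + x) = g (h + x).
    by move: fg; rewrite (near_shift 0 x) /= subr0.
  near=> h.
  have E : g (h + x) = f (h + x) by symmetry; near: h.
  rewrite /= -[_ h]/(g (h + x) - (g x + 'd f x h)) E -fgx.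
  by near: h.
apply/diff_locallyP; have := diff_unique (diff_continuous df) dg => Edg.
by rewrite Edg; split => //; exact: diff_continuous.
Unshelve. all: by end_near.
Qed.

(** Needed because the product rule only holds on U, where the factors are
    differentiable. *)
Lemma Ck_on_eq (R : realType) (N : nat) (U : set 'rV[R]_N)
    (k : nat) (f g : 'rV[R]_N -> R) :
  open U -> (forall x, U x -> f x = g x) -> Ck_on k U f -> Ck_on k U g.
Proof.
move=> oU; elim: k f g => [|k IH] f g fg /=.
  move=> cf x Ux; have near_fg : \forall y \near x, f y = g y.
    by apply: filterS (open_nbhs_nbhs (conj oU Ux)) => y; exact: fg.
  have H := cf x Ux; rewrite /prop_for /continuous_at (fg x Ux) in H.
  apply: (cvg_trans _ H); exact: (near_eq_cvg near_fg).
have near_fg x : U x -> \forall y \near x, f y = g y.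
  by move=> Ux; apply: filterS (open_nbhs_nbhs (conj oU Ux)) => y; exact: fg.
move=> [df Df]; split=> [x Ux|j].
  by apply: near_eq_differentiable (df x Ux); exact: near_fg.
apply: IH (Df j) => x Ux; apply: near_eq_derive; exact: near_fg.
Qed.

Lemma Ck_on_pred (R : realType) (N : nat) (U : set 'rV[R]_N)
    (k : nat) (f : 'rV[R]_N -> R) : Ck_on k.+1 U f -> Ck_on k U f.
Proof.
elim: k f => [|k IH] f /= [df Df].
  by move=> x Ux; apply: differentiable_continuous; exact: df.
by split=> [//|j]; apply: IH; exact: Df.
Qed.

Lemma Ck_on_cst (R : realType) (N : nat) (U : set 'rV[R]_N)
    (k : nat) (c : R) : Ck_on k U (fun=> c).
Proof.
elim: k c => [|k IH] c /=; first by move=> x _; exact: cst_continuous.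
split=> [x _|j]; first exact: differentiable_cst.
have -> : (fun x => 'D_(delta_mx 0 j) (fun=> c) x) = (fun _ : 'rV[R]_N => 0).
  by apply/funext => x; rewrite derive_cst.
exact: IH.
Qed.

Lemma derive_coord (R : realType) (N : nat) (i j : 'I_N) (x : 'rV[R]_N) :
  'D_(delta_mx 0 j) (fun y : 'rV[R]_N => y 0 i) x = (j == i)%:R.
Proof.
apply: cvg_lim => //; apply: cvg_near_cst.
rewrite near_withinE; near=> h => h0.
by rewrite /= !mxE addrK [_ *: _]mulrA mulVf // mul1r eqxx eq_sym.
Unshelve. all: by end_near.
Qed.

Lemma Ck_on_coord (R : realType) (N : nat) (U : set 'rV[R]_N)
    (k : nat) (i : 'I_N) : Ck_on k U (fun y => y 0 i).
Proof.
case: k => [|k] /=; first by move=> x _; exact: coord_continuous.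
split=> [x _|j]; first exact: differentiable_coord.
have -> : (fun x : 'rV[R]_N => 'D_(delta_mx 0 j) (fun y : 'rV[R]_N => y 0 i) x) =
  (fun=> (j == i)%:R).
  by apply/funext => x; rewrite derive_coord.
exact: Ck_on_cst.
Qed.

Lemma Ck_onD (R : realType) (N : nat) (U : set 'rV[R]_N)
    (k : nat) (f g : 'rV[R]_N -> R) : open U ->
  Ck_on k U f -> Ck_on k U g -> Ck_on k U (fun y => f y + g y).
Proof.
move=> oU; elim: k f g => [|k IH] f g /=.
  by move=> cf cg x Ux; apply: continuousD; [exact: cf|exact: cg].
move=> [df Df] [dg Dg]; split=> [x Ux|j].
  by apply: differentiableD; [exact: df|exact: dg].
apply: (Ck_on_eq oU _ (IH _ _ (Df j) (Dg j))) => x Ux.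
by rewrite (deriveD (diff_derivable (df x Ux)) (diff_derivable (dg x Ux))).
Qed.

Lemma Ck_onM (R : realType) (N : nat) (U : set 'rV[R]_N)
    (k : nat) (f g : 'rV[R]_N -> R) : open U ->
  Ck_on k U f -> Ck_on k U g -> Ck_on k U (fun y => f y * g y).
Proof.
move=> oU; elim: k f g => [|k IH] f g.
  by move=> /= cf cg x Ux; apply: continuousM; [exact: cf|exact: cg].
move=> Cf Cg; have Cf' := Ck_on_pred Cf; have Cg' := Ck_on_pred Cg.
case: Cf => df Df; case: Cg => dg Dg; split=> [x Ux|j].
  by apply: differentiableM; [exact: df|exact: dg].
apply: (Ck_on_eq oU _ (Ck_onD oU (IH _ _ Cf' (Dg j)) (IH _ _ Cg' (Df j)))).
move=> x Ux.
by rewrite (deriveM (diff_derivable (df x Ux)) (diff_derivable (dg x Ux))).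
Qed.

Definition csmooth (R : realType) (N : nat) (U : set 'rV[R]_N)
    (F : 'rV[R]_N -> R[i]) : Prop :=
  smooth_on U (fun y => complex.Re (F y)) /\
  smooth_on U (fun y => complex.Im (F y)).

Lemma csmooth_eq (R : realType) (N : nat) (U : set 'rV[R]_N)
    (F G : 'rV[R]_N -> R[i]) :
  open U -> (forall x, U x -> F x = G x) -> csmooth U F -> csmooth U G.
Proof.
by move=> oU FG [Fr Fi]; split=> k;
  [apply: (Ck_on_eq oU _ (Fr k))|apply: (Ck_on_eq oU _ (Fi k))] => x Ux;
  rewrite FG.
Qed.

Lemma csmooth_sub (R : realType) (N : nat) (U V : set 'rV[R]_N)
    (F : 'rV[R]_N -> R[i]) : U `<=` V -> csmooth V F -> csmooth U F.
Proof.
move=> UV [Fr Fi].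
have sub k f : Ck_on k V f -> Ck_on k U f.
  elim: k f => [|k IH] f /=; first by move=> cf x /UV; exact: cf.
  by move=> [df Df]; split=> [x /UV|j]; [exact: df|exact: IH].
by split=> k; apply: sub; [exact: Fr|exact: Fi].
Qed.

Lemma csmooth_cdiff (R : realType) (N : nat) (U : set 'rV[R]_N)
    (F : 'rV[R]_N -> R[i]) v : csmooth U F -> U v -> cdiff F v.
Proof. by move=> [Fr Fi] Uv; split; [have [+ _] := Fr 1|have [+ _] := Fi 1]; exact. Qed.

Lemma csmooth_cD (R : realType) (N : nat) (U : set 'rV[R]_N)
    (F : 'rV[R]_N -> R[i]) j : csmooth U F -> csmooth U (cD j F).
Proof.
by move=> [Fr Fi]; split=> k; [have [_ +] := Fr k.+1|have [_ +] := Fi k.+1];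
  exact.
Qed.

Lemma csmooth_cst (R : realType) (N : nat) (U : set 'rV[R]_N) (c : R[i]) :
  csmooth U (fun=> c).
Proof. by split=> k; exact: Ck_on_cst. Qed.

Lemma csmoothM (R : realType) (N : nat) (U : set 'rV[R]_N)
    (F G : 'rV[R]_N -> R[i]) : open U ->
  csmooth U F -> csmooth U G -> csmooth U (fun y => F y * G y).
Proof.
move=> oU [Fr Fi] [Gr Gi]; split=> k.
  have -> : (fun y => complex.Re (F y * G y)) =
    (fun y => complex.Re (F y) * complex.Re (G y) +
              -1 * (complex.Im (F y) * complex.Im (G y))).
    by apply/funext => y; rewrite cReM mulN1r.
  apply: (Ck_onD oU (Ck_onM oU (Fr k) (Gr k))).
  exact: (Ck_onM oU (Ck_on_cst U k (-1)) (Ck_onM oU (Fi k) (Gi k))).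
have -> : (fun y => complex.Im (F y * G y)) =
  (fun y => complex.Re (F y) * complex.Im (G y) +
            complex.Im (F y) * complex.Re (G y)).
  by apply/funext => y; rewrite cImM.
exact: (Ck_onD oU (Ck_onM oU (Fr k) (Gi k)) (Ck_onM oU (Fi k) (Gr k))).
Qed.

Lemma cD_comm (R : realType) (N : nat) (U : set 'rV[R]_N)
    (F : 'rV[R]_N -> R[i]) v i j : open U -> csmooth U F -> U v ->
  cD i (cD j F) v = cD j (cD i F) v.
Proof.
move=> oU [Fr Fi] Uv; rewrite /cD.
have comm (f : 'rV[R]_N -> R) : smooth_on U f ->
    'D_(delta_mx 0 i) ('D_(delta_mx 0 j) f) v =
    'D_(delta_mx 0 j) ('D_(delta_mx 0 i) f) v.
  move=> sf; have nU : nbhs v U by exact: open_nbhs_nbhs.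
  have [df Df] := sf 3.
  apply: derive_comm.
  - by apply: filterS nU => y Uy; exact: df.
  - by apply: filterS nU => y Uy; have [+ _] := Df j; exact.
  - by apply: filterS nU => y Uy; have [+ _] := Df i; exact.
  - have [_ /(_ i)[D _]] := Df j.
    by apply: differentiable_continuous; exact: D.
  - have [_ /(_ j)[D _]] := Df i.
    by apply: differentiable_continuous; exact: D.
exact: (congr2 (fun a b => a +i* b) (comm _ Fr) (comm _ Fi)).
Qed.

(** * Quaternions and the null family *)

Definition quat_triple (F : fieldType) (n : nat) (K1 K2 K3 : 'M[F]_n) : Prop :=
  [/\ K1 *m K1 = - 1%:M, K2 *m K2 = - 1%:M, K3 *m K3 = - 1%:M &
      K1 *m K2 *m K3 = - 1%:M].

(** The endomorphism attached to a quaternion with (possibly complex)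
    coordinates c0, c1, c2, c3. *)
Definition quat (F : fieldType) (n : nat) (K1 K2 K3 : 'M[F]_n)
    (c0 c1 c2 c3 : F) : 'M[F]_n :=
  c0 *: 1%:M + c1 *: K1 + c2 *: K2 + c3 *: K3.

Lemma quat_mult_table (F : fieldType) (n : nat) (K1 K2 K3 : 'M[F]_n) :
  quat_triple K1 K2 K3 ->
  [/\ K1 *m K2 = K3, K2 *m K3 = K1 & K3 *m K1 = K2] /\
  [/\ K2 *m K1 = - K3, K3 *m K2 = - K1 & K1 *m K3 = - K2].
Proof.
move=> [K11 K22 K33 K123].
have K12 : K1 *m K2 = K3.
  have : K1 *m K2 *m K3 *m K3 = - K3 by rewrite K123 mulNmx mul1mx.
  by rewrite -mulmxA K33 mulmxN mulmx1 => /oppr_inj.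
have K23 : K2 *m K3 = K1.
  have : K1 *m (K1 *m K2 *m K3) = - K1 by rewrite K123 mulmxN mulmx1.
  by rewrite !mulmxA K11 !mulNmx mul1mx => /oppr_inj.
have K21 : K2 *m K1 = - K3 by rewrite -K23 mulmxA K22 mulNmx mul1mx.
have K32 : K3 *m K2 = - K1 by rewrite -K12 -mulmxA K22 mulmxN mulmx1.
have K13 : K1 *m K3 = - K2 by rewrite -K12 mulmxA K11 mulNmx mul1mx.
have K31 : K3 *m K1 = K2 by rewrite -K23 mulmxA K32 mulNmx K13 opprK.
by [].
Qed.

Lemma quatM (F : fieldType) (n : nat) (K1 K2 K3 : 'M[F]_n) a0 a1 a2 a3
    b0 b1 b2 b3 : quat_triple K1 K2 K3 ->
  quat K1 K2 K3 a0 a1 a2 a3 *m quat K1 K2 K3 b0 b1 b2 b3 =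
  quat K1 K2 K3 (a0 * b0 - a1 * b1 - a2 * b2 - a3 * b3)
                (a0 * b1 + a1 * b0 + a2 * b3 - a3 * b2)
                (a0 * b2 + a2 * b0 + a3 * b1 - a1 * b3)
                (a0 * b3 + a3 * b0 + a1 * b2 - a2 * b1).
Proof.
move=> KK; have [[K12 K23 K31] [K21 K32 K13]] := quat_mult_table KK.
have [K11 K22 K33 _] := KK.
rewrite /quat !mulmxDl !mulmxDr -!scalemxAl -!scalemxAr.
rewrite !mul1mx !mulmx1 K11 K22 K33 K12 K23 K31 K21 K32 K13.
move: 1%:M => E; apply/matrixP => i j; rewrite !mxE; ring.
Qed.

Lemma quat_eq (F : fieldType) (n : nat) (K1 K2 K3 : 'M[F]_n) a0 a1 a2 a3
    b0 b1 b2 b3 : a0 = b0 -> a1 = b1 -> a2 = b2 -> a3 = b3 ->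
  quat K1 K2 K3 a0 a1 a2 a3 = quat K1 K2 K3 b0 b1 b2 b3.
Proof. by move=> -> -> -> ->. Qed.

Lemma quatD (F : fieldType) (n : nat) (K1 K2 K3 : 'M[F]_n) a0 a1 a2 a3
    b0 b1 b2 b3 :
  quat K1 K2 K3 a0 a1 a2 a3 + quat K1 K2 K3 b0 b1 b2 b3 =
  quat K1 K2 K3 (a0 + b0) (a1 + b1) (a2 + b2) (a3 + b3).
Proof.
rewrite /quat; move: 1%:M => E; apply/matrixP => i j; rewrite !mxE; ring.
Qed.

Lemma quatZ (F : fieldType) (n : nat) (K1 K2 K3 : 'M[F]_n) c a0 a1 a2 a3 :
  c *: quat K1 K2 K3 a0 a1 a2 a3 =
  quat K1 K2 K3 (c * a0) (c * a1) (c * a2) (c * a3).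
Proof. by rewrite /quat !scalerDr !scalerA. Qed.

Lemma quat_scalar (F : fieldType) (n : nat) (K1 K2 K3 : 'M[F]_n) c :
  c *: 1%:M = quat K1 K2 K3 c 0 0 0.
Proof. by rewrite /quat !scale0r !addr0. Qed.

(** This is 2 zeta I(zeta) for the triple (K1, s K2, s K3), where im is a square
    root of -1 and s = 1 or -1; the factor 2 removes the denominators. *)
Definition null_quat (F : fieldType) (n : nat) (K1 K2 K3 : 'M[F]_n) (im s z : F) :=
  quat K1 K2 K3 0 (1 - z ^+ 2) (s * im * (1 + z ^+ 2)) (2 * s * z).

Definition null_quat_der (F : fieldType) (n : nat) (K1 K2 K3 : 'M[F]_n) (im s z : F) :=
  quat K1 K2 K3 0 (- 2 * z) (2 * s * im * z) (2 * s).

Lemma quat_unit_sqr (F : fieldType) (n : nat) (K1 K2 K3 : 'M[F]_n) y1 y2 y3 :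
  quat_triple K1 K2 K3 -> y1 ^+ 2 + y2 ^+ 2 + y3 ^+ 2 = 1 ->
  quat K1 K2 K3 0 y1 y2 y3 *m quat K1 K2 K3 0 y1 y2 y3 = - 1%:M.
Proof.
move=> KK y; rewrite quatM // -[RHS]/(- 1%:M) -scaleN1r (quat_scalar K1 K2 K3).
apply: quat_eq; try ring.
by rewrite -y; ring.
Qed.

Section NullQuatRelations.
Context (F : fieldType) (n : nat) (K1 K2 K3 : 'M[F]_n) (im s : F).
Context (KK : quat_triple K1 K2 K3) (im2 : im * im = -1) (s2 : s * s = 1).
Let M z := null_quat K1 K2 K3 im s z.
Let dM z := null_quat_der K1 K2 K3 im s z.

(** The quaternion (1 - z^2, s im (1 + z^2), 2 s z) is purely imaginary and
    isotropic. *)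
Lemma null_quat_sqr z : M z *m M z = 0.
Proof.
have -> : 0 = quat K1 K2 K3 0 0 0 0 by rewrite /quat !scale0r !addr0.
by rewrite /M /null_quat quatM //; apply: quat_eq; ring: im2 s2.
Qed.

(** The left factor null_quat_der acts on the image of null_quat as - 2 im; with
    [unit_quat_null_quat] this says that the columns of null_quat are of
    type (0,1). *)
Lemma null_quat_der_mul z : dM z *m M z = (- 2 * im) *: M z.
Proof.
by rewrite /M /dM /null_quat /null_quat_der quatM // quatZ; apply: quat_eq; ring: im2 s2.
Qed.

Lemma null_quat_der_quotient z :
  dM z = (2 * im) *: 1%:M + M z *m quat K1 K2 K3 0 im s 0.
Proof.
rewrite /M /dM /null_quat /null_quat_der quatM // (quat_scalar K1 K2 K3) quatD.
by apply: quat_eq; ring: im2 s2.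
Qed.

Lemma null_quat_left_null m (a : 'M[F]_(m, n)) z : a *m M z = 0 ->
  a *m dM z = (2 * im) *: a.
Proof.
by move=> aM; rewrite null_quat_der_quotient mulmxDr mulmxA aM mul0mx addr0
  -scalemxAr mulmx1.
Qed.

(** The complex structure at a point of the sphere, in terms of its
    stereographic coordinate z.  The antiholomorphic dependence on z is confined
    to the coefficient of null_quat. *)
Lemma unit_quat_null_quat y1 y2 y3 : y1 ^+ 2 + y2 ^+ 2 + y3 ^+ 2 = 1 ->
  1 + s * y3 != 0 ->
  let z := - (y1 + s * im * y2) / (1 + s * y3) in
  2 *: quat K1 K2 K3 0 y1 y2 y3 = dM z + (y1 - s * im * y2) *: M z.
Proof.
move=> y y30 z.
have Ez : z * (1 + s * y3) = - (y1 + s * im * y2) by rewrite /z divfK.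
(* from y1^2 + y2^2 = (1 - s y3) (1 + s y3) *)
have Emu : (y1 - s * im * y2) * z = - (1 - s * y3).
  apply: (mulIf y30); rewrite -[LHS]mulrA Ez.
  transitivity (- (y1 ^+ 2 + y2 ^+ 2 + y3 ^+ 2) + y3 ^+ 2); first by ring: im2 s2.
  by rewrite y; ring: s2.
have Ez' : s * y3 * z = - (y1 + s * im * y2) - z by rewrite -Ez; ring.
have Emu2 : (y1 - s * im * y2) * z ^+ 2 = - y1 - s * im * y2 - 2 * z.
  by rewrite expr2 mulrA Emu mulNr mulrBl mul1r Ez'; ring.
have [mu Dmu] : {mu | mu = y1 - s * im * y2} by exists (y1 - s * im * y2).
rewrite -Dmu in Emu Emu2 *.
rewrite /M /dM /null_quat /null_quat_der !quatZ quatD; apply: quat_eq; first by ring.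
- rewrite mulrBr Emu2 Dmu; ring.
- transitivity (2 * s * im * z + s * im * (mu + mu * z ^+ 2)); last by ring.
  by rewrite Emu2 Dmu; ring: im2 s2.
- transitivity (2 * s + 2 * s * (mu * z)); last by ring.
  by rewrite Emu; ring: s2.
Qed.

Context (F2 : 2 != 0 :> F).

(** The key criterion: being of type (1,0) is a condition that varies
    holomorphically along the sphere. *)
Lemma eigenform_null_quat m (a : 'M[F]_(m, n)) y1 y2 y3 :
  y1 ^+ 2 + y2 ^+ 2 + y3 ^+ 2 = 1 -> 1 + s * y3 != 0 ->
  a *m quat K1 K2 K3 0 y1 y2 y3 = im *: a <->
  a *m M (- (y1 + s * im * y2) / (1 + s * y3)) = 0.
Proof.
move=> y y30; have J := unit_quat_null_quat y y30; move: J.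
set z := - _ / _ => /= J; set Y := quat _ _ _ _ _ _ _ in J *; split=> [aJ|aM].
  have YM : Y *m M z = - im *: M z.
    apply: (scalerI F2); rewrite scalemxAl J mulmxDl -scalemxAl null_quat_sqr.
    by rewrite scaler0 addr0 null_quat_der_mul scalerA mulrN mulNr.
  have : a *m Y *m M z = a *m Y *m M z by [].
  rewrite {1}aJ -mulmxA YM -scalemxAl -scalemxAr scaleNr => /eqP.
  rewrite -subr_eq0 opprK -mulr2n -scaler_nat scalerA scalemx_eq0.
  rewrite mulf_eq0 (negPf F2) /= => /orP[/eqP im0|/eqP //].
  by move: im2; rewrite im0 mulr0 => /eqP; rewrite eq_sym oppr_eq0 oner_eq0.
apply: (scalerI F2); rewrite scalemxAr J mulmxDr -scalemxAr aM scaler0.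
by rewrite addr0 null_quat_left_null // scalerA.
Qed.

End NullQuatRelations.

(** * The (1,1)-part of a 2-form on a product *)

Lemma sqr_im (R : realType) : 'i * 'i = -1 :> R[i].
Proof. by rewrite -expr2 sqr_i. Qed.

Lemma im_neq0 (R : realType) : 'i != 0 :> R[i].
Proof. by rewrite eq_complex /= oner_eq0 andbF. Qed.

Lemma two_neq0 (R : realType) : 2 != 0 :> R[i].
Proof. by rewrite pnatr_eq0. Qed.

Lemma proj01_eq0 (R : realType) n m (J : 'M[R]_n) (c : 'M[R[i]]_(m, n)) :
  c *m proj01 J = 0 <-> c *m map_mx (real_complex R) J = 'i *: c.
Proof.
rewrite /proj01 -scalemxAr mulmxDr mulmx1 -scalemxAr; split=> [/eqP|->].
  rewrite scalemx_eq0 invr_eq0 (negPf (two_neq0 R)) /= => /eqP E.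
  apply: (scalerI (im_neq0 R)); rewrite scalerA sqr_im scaleN1r.
  by apply/eqP; rewrite -addr_eq0 addrC E.
by rewrite scalerA sqr_im scaleN1r subrr scaler0.
Qed.

Lemma proj10_opp (R : realType) n (J : 'M[R]_n) : proj10 J = proj01 (- J).
Proof. by rewrite /proj10 /proj01 map_mxN scalerN. Qed.

Lemma proj10_eq0 (R : realType) n m (J : 'M[R]_n) (c : 'M[R[i]]_(m, n)) :
  c *m proj10 J = 0 <-> c *m map_mx (real_complex R) J = - 'i *: c.
Proof.
rewrite proj10_opp proj01_eq0 map_mxN mulmxN scaleNr.
by split=> [<-|->]; rewrite opprK.
Qed.

Lemma proj10_add01 (R : realType) n (J : 'M[R]_n) :
  proj10 J + proj01 J = 1%:M.
Proof.
rewrite /proj10 /proj01 -scalerDr addrACA addNr addr0 -mulr2n.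
rewrite -(scaler_nat 2 1%:M).
by rewrite scalerA mulVf ?scale1r // two_neq0.
Qed.

Lemma proj10_proj01 (R : realType) n (J : 'M[R]_n) : J *m J = - 1%:M ->
  proj10 J *m proj01 J = 0.
Proof.
move=> J2; apply/proj01_eq0; rewrite /proj10 -scalemxAl mulmxBl mul1mx.
rewrite -scalemxAl -map_mxM J2 map_mxN map_mx1 scalerN opprK.
rewrite scalerA mulrC -scalerA scalerBr scalerA sqr_im scaleN1r opprK.
by rewrite addrC.
Qed.

Lemma proj01_proj10 (R : realType) n (J : 'M[R]_n) : J *m J = - 1%:M ->
  proj01 J *m proj10 J = 0.
Proof.
move=> J2; have -> : proj01 J = 1%:M - proj10 J.
  by rewrite -(proj10_add01 J) addrAC subrr add0r.
have PE : proj10 J = 1%:M - proj01 J by rewrite -(proj10_add01 J) addrK.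
rewrite mulmxBl mul1mx {3}PE mulmxBr mulmx1 proj10_proj01 // subr0.
exact: subrr.
Qed.

Lemma part11_type11 (R : realType) n (J : 'M[R]_n) W : J *m J = - 1%:M ->
  type11 J (part11 J W).
Proof.
move=> J2; have PQ := proj10_proj01 J2; have QP := proj01_proj10 J2.
have PtQt : (proj10 J)^T *m (proj01 J)^T = 0 by rewrite -trmx_mul QP trmx0.
have QtPt : (proj01 J)^T *m (proj10 J)^T = 0 by rewrite -trmx_mul PQ trmx0.
rewrite /type11 /part11.
move: (proj10 J) (proj01 J) PQ QP PtQt QtPt => P Q PQ QP PtQt QtPt.
split; rewrite mulmxDr mulmxDl !mulmxA ?PtQt ?QtPt !mul0mx.
  by rewrite addr0 -mulmxA QP mulmx0.
by rewrite add0r -mulmxA PQ mulmx0.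
Qed.

Lemma proj10_block (R : realType) n k (J : 'M[R]_n) (J' : 'M[R]_k) :
  proj10 (block_mx J 0 0 J') = block_mx (proj10 J) 0 0 (proj10 J').
Proof.
rewrite /proj10 map_block_mx !map_mx0 scalar_mx_block scale_block_mx !scaler0.
by rewrite opp_block_mx add_block_mx scale_block_mx !oppr0 !addr0 !scaler0.
Qed.

Lemma proj01_block (R : realType) n k (J : 'M[R]_n) (J' : 'M[R]_k) :
  proj01 (block_mx J 0 0 J') = block_mx (proj01 J) 0 0 (proj01 J').
Proof.
rewrite /proj01 map_block_mx !map_mx0 scalar_mx_block scale_block_mx !scaler0.
by rewrite add_block_mx scale_block_mx !addr0 !scaler0.
Qed.

(** The off-diagonal block of the (1,1)-part of a 2-form on a product of two
    spaces with complex structures J and J'. *)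
Definition mixed11 (R : realType) n k (J : 'M[R]_n) (J' : 'M[R]_k)
    (B : 'M[R[i]]_(n, k)) : 'M[R[i]]_(n, k) :=
  (proj10 J)^T *m B *m proj01 J' + (proj01 J)^T *m B *m proj10 J'.

Lemma part11_block (R : realType) n k (J : 'M[R]_n) (J' : 'M[R]_k) A B C D :
  part11 (block_mx J 0 0 J') (block_mx A B C D) =
  block_mx (part11 J A) (mixed11 J J' B) (mixed11 J' J C) (part11 J' D).
Proof.
rewrite /part11 /mixed11 proj10_block proj01_block.
move: (proj10 J) (proj01 J) (proj10 J') (proj01 J') => P Q P' Q'.
rewrite !tr_block_mx !mulmx_block add_block_mx !trmx0 !mul0mx !mulmx0.
by rewrite !(addr0, add0r, mul0mx, mulmx0).
Qed.

Lemma mixed11_tr (R : realType) n k (J : 'M[R]_n) (J' : 'M[R]_k) B :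
  mixed11 J' J B^T = (mixed11 J J' B)^T.
Proof.
rewrite /mixed11.
move: (proj10 J) (proj01 J) (proj10 J') (proj01 J') => P Q P' Q'.
by rewrite linearD /= !trmx_mul !trmxK addrC !mulmxA.
Qed.

(** The two summands lie in complementary subspaces. *)
Lemma mixed11_eq0 (R : realType) n k (J : 'M[R]_n) (J' : 'M[R]_k) B :
  J *m J = - 1%:M -> mixed11 J J' B = 0 <->
  (proj10 J)^T *m (B *m proj01 J') = 0 /\ (proj01 J)^T *m (B *m proj10 J') = 0.
Proof.
move=> J2; have PQ := proj10_proj01 J2; have QP := proj01_proj10 J2.
have P1 := proj10_add01 J; rewrite /mixed11.
move: (proj10 J) (proj01 J) (proj10 J') (proj01 J') PQ QP P1.
move=> P Q P' Q' PQ QP P1; split=> [E|[]]; last first.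
  by rewrite !mulmxA => -> ->; rewrite addr0.
have QtPt : Q^T *m P^T = 0 by rewrite -trmx_mul PQ trmx0.
have E0 : Q^T *m (Q^T *m (B *m P')) = 0.
  have := congr1 (mulmx Q^T) E.
  by rewrite mulmx0 mulmxDr !mulmxA QtPt !mul0mx add0r.
have E1 : Q^T *m (B *m P') = 0.
  rewrite -[LHS]mul1mx -(trmx1 _ n) -P1 linearD /= mulmxDl E0.
  by rewrite addr0 mulmxA -trmx_mul QP trmx0 mul0mx.
by split=> //; move: E; rewrite -!mulmxA E1 addr0.
Qed.

Lemma ord2P (j : 'I_2) : j = 0 \/ j = 1.
Proof.
by case: j => [[|[|//]] ?]; [left|right]; apply/val_inj.
Qed.

Lemma J_CP1_sqr (R : realType) : J_CP1 *m J_CP1 = - 1%:M :> 'M[R]_2.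
Proof.
apply/matrixP => i j; rewrite !mxE !big_ord_recl big_ord0 !mxE.
by case: (ord2P i) => ->; case: (ord2P j) => -> /=; ring.
Qed.

Lemma mul_J_CP1 (R : realType) m (B : 'M[R[i]]_(m, 2)) l :
  (B *m map_mx (real_complex R) J_CP1) l 0 = B l 1 /\
  (B *m map_mx (real_complex R) J_CP1) l 1 = - B l 0.
Proof.
have L : lift ord0 ord0 = 1 :> 'I_2 by exact/val_inj.
rewrite !mxE !big_ord_recl !big_ord0 !mxE L /= !rmorphN rmorph1 rmorph0.
by rewrite !(mulr0, mulr1, add0r, addr0, mulrN1).
Qed.

Lemma mul_proj01_CP1 (R : realType) m (B : 'M[R[i]]_(m, 2)) :
  B *m proj01 J_CP1 = 0 <-> col 0 B + 'i *: col 1 B = 0.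
Proof.
have E := mul_J_CP1 B.
rewrite proj01_eq0; split=> [BJ|B0].
  apply/matrixP => l j; have [_ E1] := E l.
  rewrite !mxE; apply/eqP; rewrite addrC addr_eq0 -E1 BJ mxE; exact/eqP.
have B0l l : B l 0 = - ('i * B l 1).
  have := congr1 (fun X : 'cV__ => X l 0) B0.
  by rewrite !mxE => /eqP; rewrite addr_eq0 => /eqP.
apply/matrixP => l j; have [E0 E1] := E l.
rewrite [RHS]mxE; case: (ord2P j) => ->; first by rewrite E0 B0l; ring: (sqr_im R).
by rewrite E1 B0l opprK.
Qed.

Lemma mul_proj10_CP1 (R : realType) m (B : 'M[R[i]]_(m, 2)) :
  B *m proj10 J_CP1 = 0 <-> col 0 B - 'i *: col 1 B = 0.
Proof.
have E := mul_J_CP1 B.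
rewrite proj10_eq0; split=> [BJ|B0].
  apply/matrixP => l j; have [E0 _] := E l.
  by rewrite !mxE -E0 BJ mxE; ring: (sqr_im R).
have B0l l : B l 0 = 'i * B l 1.
  have := congr1 (fun X : 'cV__ => X l 0) B0.
  by rewrite !mxE => /eqP; rewrite subr_eq0 => /eqP.
apply/matrixP => l j; have [E0 E1] := E l.
rewrite [RHS]mxE; case: (ord2P j) => ->; first by rewrite E0 B0l; ring: (sqr_im R).
by rewrite E1 B0l; ring.
Qed.

Lemma col_comb (F : fieldType) p m (A : 'M[F]_(p, m)) (B : 'M[F]_(m, 2)) c :
  col 0 (A *m B) + c *: col 1 (A *m B) = A *m (col 0 B + c *: col 1 B).
Proof. by rewrite mulmxDr -scalemxAr !colE !mulmxA. Qed.

Lemma tr_mul_eq0 (F : fieldType) m n (A : 'M[F]_(m, n)) (c : 'cV[F]_m) :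
  A^T *m c = 0 <-> c^T *m A = 0.
Proof.
by split=> E; apply: trmx_inj; rewrite trmx_mul ?trmxK trmx0.
Qed.

(** On a complex line there are no forms of type (2,0) or (0,2). *)
Lemma part11_CP1 (R : realType) (D : 'M[R[i]]_2) : D^T = - D ->
  part11 J_CP1 D = D.
Proof.
move=> DT.
have Dlk l k : D k l = - D l k.
  by have := congr1 (fun X : 'M[R[i]]_2 => X l k) DT; rewrite !mxE.
have Dll l : D l l = 0.
  apply/eqP; have := Dlk l l => /eqP; rewrite -subr_eq0 opprK -mulr2n.
  by rewrite mulrn_eq0.
have QQ : (proj01 J_CP1)^T *m D *m proj01 J_CP1 = 0.
  apply/mul_proj01_CP1; rewrite col_comb; apply/tr_mul_eq0/mul_proj01_CP1.
  apply/matrixP => k l; rewrite !mxE !Dll (Dlk 0 1).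
  by rewrite mulr0 addr0 add0r mulrN addrN.
have PP : (proj10 J_CP1)^T *m D *m proj10 J_CP1 = 0.
  apply/mul_proj10_CP1; rewrite -scaleNr col_comb; apply/tr_mul_eq0.
  apply/mul_proj10_CP1; apply/matrixP => k l.
  rewrite !mxE !Dll (Dlk 0 1).
  ring.
have P1 := proj10_add01 (@J_CP1 R); rewrite /part11.
move: (proj10 J_CP1) (proj01 J_CP1) P1 PP QQ => P Q P1 PP QQ.
transitivity ((P + Q)^T *m D *m (P + Q)).
  rewrite [(P + Q)^T]linearD /= !mulmxDl !mulmxDr.
  by rewrite PP QQ add0r addr0 addrC.
by rewrite P1 trmx1 mul1mx mulmx1.
Qed.

(** The columns 0 and 1 of the upper right block W are the contractions with
    the real coordinate fields of the sphere; their combinations with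
    coefficients 'i and - 'i are twice the contractions with d/dzetabar and
    d/dzeta. *)
Lemma fiber11_matrix (R : realType) n (J : 'M[R]_n) (W : 'M[R[i]]_(n + 2)) :
  J *m J = - 1%:M -> W^T = - W ->
  let T := block_mx J 0 0 J_CP1 in
  [/\ type11 T (part11 T W), ursubmx (part11 T W) = 0,
      dlsubmx (part11 T W) = 0 & drsubmx (part11 T W) = 0] <->
  [/\ (col 0 (ursubmx W) + 'i *: col 1 (ursubmx W))^T *m proj10 J = 0,
      (col 0 (ursubmx W) - 'i *: col 1 (ursubmx W))^T *m proj01 J = 0 &
      drsubmx W = 0].
Proof.
move=> J2 WT T.
have T2 : T *m T = - 1%:M.
  rewrite mulmx_block J2 J_CP1_sqr !mul0mx !mulmx0 !addr0 add0r.
  by rewrite [in RHS]scalar_mx_block opp_block_mx !oppr0.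
have [A [B [C [D DW]]]] : exists A B C D, W = block_mx A B C D.
  by exists (ulsubmx W), (ursubmx W), (dlsubmx W), (drsubmx W); rewrite submxK.
move: WT; rewrite DW tr_block_mx opp_block_mx => /eq_block_mx[_ _ BT DT].
have EC : C = - B^T by rewrite BT opprK.
have := part11_type11 (block_mx A B C D) T2.
rewrite part11_block !block_mxKur block_mxKdl !block_mxKdr (part11_CP1 DT) EC.
move=> T11.
have dl : mixed11 J_CP1 J (- B^T) = - (mixed11 J J_CP1 B)^T.
  rewrite -mixed11_tr /mixed11.
  move: (proj10 J) (proj01 J) (proj10 J_CP1) (proj01 J_CP1) => P Q P' Q'.
  by rewrite !mulmxN !mulNmx -opprD.
have key : mixed11 J J_CP1 B = 0 <->
  (col 0 B + 'i *: col 1 B)^T *m proj10 J = 0 /\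
  (col 0 B - 'i *: col 1 B)^T *m proj01 J = 0.
  rewrite mixed11_eq0 //; move: (proj10 J) (proj01 J) => P Q.
  have k1 : P^T *m (B *m proj01 J_CP1) = 0 <->
            (col 0 B + 'i *: col 1 B)^T *m P = 0.
    by rewrite mulmxA mul_proj01_CP1 col_comb; exact: tr_mul_eq0.
  have k2 : Q^T *m (B *m proj10 J_CP1) = 0 <->
            (col 0 B - 'i *: col 1 B)^T *m Q = 0.
    by rewrite mulmxA mul_proj10_CP1 -!scaleNr col_comb; exact: tr_mul_eq0.
  by split=> [[/k1 ? /k2 ?]|[/k1 ? /k2 ?]].
split=> [[_ /key[E1 E2] _ ->] //|[E1 E2 E3]].
have E : mixed11 J J_CP1 B = 0 by apply/key.
by split=> //; rewrite dl E trmx0 oppr0.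
Qed.

(** * The equations at a point *)

Definition sphere_coord (R : realType) (n : nat) (v : 'rV[R]_(n + 2)) : R[i] :=
  v 0 (rshift n 0) +i* v 0 (rshift n 1).

Lemma sphere_coord_cdiff (R : realType) (n : nat) (v : 'rV[R]_(n + 2)) :
  cdiff (@sphere_coord R n) v.
Proof. by split; exact: differentiable_coord. Qed.

Lemma cD_sphere_coord (R : realType) (n : nat) j (v : 'rV[R]_(n + 2)) :
  cD j (@sphere_coord R n) v = (j == rshift n 0)%:R +i* (j == rshift n 1)%:R.
Proof. by rewrite /cD /sphere_coord /= !derive_coord. Qed.

Lemma cD_sphere_coord0 (R : realType) (n : nat) (v : 'rV[R]_(n + 2)) :
  cD (rshift n 0) (@sphere_coord R n) v = 1.
Proof. by rewrite cD_sphere_coord eqxx eq_rshift. Qed.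

Lemma cD_sphere_coord1 (R : realType) (n : nat) (v : 'rV[R]_(n + 2)) :
  cD (rshift n 1) (@sphere_coord R n) v = 'i.
Proof. by rewrite cD_sphere_coord eqxx eq_rshift. Qed.

Lemma cD_sphere_coordl (R : realType) (n : nat) l (v : 'rV[R]_(n + 2)) :
  cD (lshift 2 l) (@sphere_coord R n) v = 0.
Proof. by rewrite cD_sphere_coord !eq_lrshift. Qed.

Lemma null_quatE (F : fieldType) n (K1 K2 K3 : 'M[F]_n) im s z k l :
  null_quat K1 K2 K3 im s z k l =
  (K1 k l + s * im * K2 k l) +
  z * ((2 * s * K3 k l) + z * (s * im * K2 k l - K1 k l)).
Proof. by rewrite !mxE; ring. Qed.

Lemma null_quat_derE (F : fieldType) n (K1 K2 K3 : 'M[F]_n) im s z k l :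
  null_quat_der K1 K2 K3 im s z k l =
  2 * s * K3 k l + 2 * z * (s * im * K2 k l - K1 k l).
Proof. by rewrite !mxE; ring. Qed.

Lemma null_quat_cdiff (R : realType) n (K1 K2 K3 : 'M[R[i]]_n) im s k l
    (v : 'rV[R]_(n + 2)) :
  cdiff (fun y => null_quat K1 K2 K3 im s (sphere_coord y) k l) v.
Proof.
under eq_fun do rewrite null_quatE.
have Z := sphere_coord_cdiff v.
apply: cdiffD; first exact: cdiff_cst.
apply: cdiffM => //; apply: cdiffD; first exact: cdiff_cst.
by apply: cdiffM => //; exact: cdiff_cst.
Qed.

Lemma cD_null_quat (R : realType) n (K1 K2 K3 : 'M[R[i]]_n) im s j k l
    (v : 'rV[R]_(n + 2)) :
  cD j (fun y => null_quat K1 K2 K3 im s (sphere_coord y) k l) v =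
  cD j (@sphere_coord R n) v * null_quat_der K1 K2 K3 im s (sphere_coord v) k l.
Proof.
under eq_fun do rewrite null_quatE.
have Z := sphere_coord_cdiff v; have cst c := cdiff_cst c v.
have ZK : cdiff (fun y => sphere_coord y * (s * im * K2 k l - K1 k l)) v.
  exact: cdiffM.
have AZK : cdiff (fun y => 2 * s * K3 k l +
    sphere_coord y * (s * im * K2 k l - K1 k l)) v by exact: cdiffD.
rewrite (cDD _ (cst _) (cdiffM Z AZK)) (cDM _ Z AZK) (cDD _ (cst _) ZK).
rewrite (cDM _ Z (cst _)) !cD_cst null_quat_derE; ring.
Qed.

Definition der_along_M (R : realType) (n : nat) (F : 'rV[R]_(n + 2) -> R[i])
    (v : 'rV[R]_(n + 2)) : 'rV[R[i]]_n :=
  \row_l cD (lshift 2 l) F v.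

Definition Mpart_der (R : realType) (n : nat)
    (G : 'rV[R]_(n + 2) -> 'rV[R[i]]_(n + 2)) j (v : 'rV[R]_(n + 2)) :
    'rV[R[i]]_n :=
  \row_l cD j (fun y => G y 0 (lshift 2 l)) v.

(** Differentiation along the sphere of the type condition, with the
    endomorphisms K1, K2, K3 of the fixed point of M as constants. *)
Lemma null_Mpart_der (R : realType) n (K1 K2 K3 : 'M[R[i]]_n) im s
    (G : 'rV[R]_(n + 2) -> 'rV[R[i]]_(n + 2)) j v :
  (forall k, cdiff (fun y => G y 0 k) v) ->
  (forall t, let y := t *: delta_mx 0 j + v in
     lsubmx (G y) *m null_quat K1 K2 K3 im s (sphere_coord y) = 0) ->
  Mpart_der G j v *m null_quat K1 K2 K3 im s (sphere_coord v) +
  cD j (@sphere_coord R n) v *: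
    (lsubmx (G v) *m null_quat_der K1 K2 K3 im s (sphere_coord v)) = 0.
Proof.
move=> dG G0; apply/rowP => l; rewrite !mxE.
have dN k := null_quat_cdiff K1 K2 K3 im s k l v.
have := cD_cst 0 j v.
rewrite (_ : cD j (fun=> 0) v = cD j (fun y =>
  \sum_k G y 0 (lshift 2 k) * null_quat K1 K2 K3 im s (sphere_coord y) k l) v).
  rewrite (cD_sum _ _ (fun k => cdiffM (dG _) (dN k))) => E.
  rewrite -[RHS]E mulr_sumr -big_split /=; apply: eq_bigr => k _.
  rewrite (cDM _ (dG _) (dN k)) cD_null_quat !mxE; ring.
apply: cD_line; near=> t; have := congr1 (fun X : 'rV[R[i]]_n => X 0 l) (G0 t).
rewrite !mxE => E; rewrite -[LHS]E; apply: eq_bigr => k _.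
by rewrite mxE.
Unshelve. all: by end_near.
Qed.

Definition ext_der (R : realType) N (G : 'rV[R]_N -> 'rV[R[i]]_N) v :
    'M[R[i]]_N :=
  \matrix_(j, k) (cD j (fun y => G y 0 k) v - cD k (fun y => G y 0 j) v).

(** The function b is the coefficient of dzeta in G.  The three conditions on
    the right are dbar b = 0, 2 a = i (d_M b) N and dbar a = 0. *)
Lemma fiber11_pointwise (R : realType) n (J : 'M[R]_n) (K1 K2 K3 : 'M[R[i]]_n)
    (s y1 y2 y3 : R[i]) (G : 'rV[R]_(n + 2) -> 'rV[R[i]]_(n + 2)) v :
  J *m J = - 1%:M -> quat_triple K1 K2 K3 -> s * s = 1 ->
  map_mx (real_complex R) J = quat K1 K2 K3 0 y1 y2 y3 ->
  y1 ^+ 2 + y2 ^+ 2 + y3 ^+ 2 = 1 -> 1 + s * y3 != 0 ->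
  sphere_coord v = - (y1 + s * 'i * y2) / (1 + s * y3) ->
  (forall k, cdiff (fun y => G y 0 k) v) ->
  (\forall y \near v, G y 0 (rshift n 1) = 'i * G y 0 (rshift n 0)) ->
  (forall (j : 'I_2) t, let y := t *: delta_mx 0 (rshift n j) + v in
     lsubmx (G y) *m null_quat K1 K2 K3 'i s (sphere_coord y) = 0) ->
  let T := block_mx J 0 0 J_CP1 in
  let W := ext_der G v in
  let b := fun y => G y 0 (rshift n 0) in
  [/\ type11 T (part11 T W), ursubmx (part11 T W) = 0,
      dlsubmx (part11 T W) = 0 & drsubmx (part11 T W) = 0] <->
  [/\ cD (rshift n 0) b v + 'i * cD (rshift n 1) b v = 0,
      2 *: lsubmx (G v) =
        'i *: (der_along_M b v *m null_quat K1 K2 K3 'i s (sphere_coord v)) &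
      Mpart_der G (rshift n 0) v + 'i *: Mpart_der G (rshift n 1) v = 0].
Proof.
move=> J2 KK s2 JE y y30 zE dG Gi G0 T W b.
have i2 := sqr_im R; have n2 := two_neq0 R.
have WT : W^T = - W by apply/matrixP => j k; rewrite !mxE opprB.
have bi : \forall y \near v, G y 0 (rshift n 1) = 'i * b y by [].
have db1 j : cD j (fun y => G y 0 (rshift n 1)) v = 'i * cD j b v.
  rewrite (cD_near _ bi) (cDM _ (cdiff_cst _ _) (dG _)) cD_cst.
  by rewrite mul0r add0r.
have D0 := null_Mpart_der dG (G0 0); have D1 := null_Mpart_der dG (G0 1).
rewrite cD_sphere_coord0 scale1r in D0; rewrite cD_sphere_coord1 in D1.
have aM : lsubmx (G v) *m null_quat K1 K2 K3 'i s (sphere_coord v) = 0.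
  by have := G0 0 0; rewrite /= scale0r add0r.
have adM := null_quat_left_null KK i2 s2 aM; rewrite adM in D0 D1.
have typeP (c : 'rV[R[i]]_n) : c *m proj01 J = 0 <->
    c *m null_quat K1 K2 K3 'i s (sphere_coord v) = 0.
  by rewrite proj01_eq0 JE zE; exact: eigenform_null_quat.
rewrite (fiber11_matrix J2 WT).
have -> : (col 0 (ursubmx W) + 'i *: col 1 (ursubmx W))^T =
    - (Mpart_der G (rshift n 0) v + 'i *: Mpart_der G (rshift n 1) v).
  apply/rowP => l; rewrite !mxE db1 -/b; ring: i2.
have -> : (col 0 (ursubmx W) - 'i *: col 1 (ursubmx W))^T =
    2 *: der_along_M b v -
    (Mpart_der G (rshift n 0) v - 'i *: Mpart_der G (rshift n 1) v).
  apply/rowP => l; rewrite !mxE db1 -/b; ring: i2.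
set M := null_quat _ _ _ _ _ _ in aM typeP D0 D1 *.
set a := lsubmx (G v) in aM adM D0 D1 *.
set d0 := Mpart_der G (rshift n 0) v in D0 *.
set d1 := Mpart_der G (rshift n 1) v in D1 *.
have d0M : d0 *m M = - ((2 * 'i) *: a) by apply/eqP; rewrite -addr_eq0 D0.
have d1M : d1 *m M = 2 *: a.
  apply/eqP; rewrite -subr_eq0 -[X in _ == X]D1 scalerA.
  by rewrite mulrCA i2 mulrN1 scaleNr.
have dbarM : (d0 + 'i *: d1) *m M = 0.
  by rewrite mulmxDl -scalemxAl d0M d1M scalerA [_ * 2]mulrC addNr.
have E3 : - (d0 + 'i *: d1) *m proj10 J = 0 <-> d0 + 'i *: d1 = 0.
  rewrite mulNmx; split=> [/eqP|->]; last by rewrite mul0mx oppr0.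
  rewrite oppr_eq0 => /eqP E; rewrite -[LHS]mulmx1 -(proj10_add01 J) mulmxDr E.
  by rewrite (typeP _).2 // addr0.
have E2 : (2 *: der_along_M b v - (d0 - 'i *: d1)) *m proj01 J = 0 <->
    2 *: a = 'i *: (der_along_M b v *m M).
  have EE : (2 *: der_along_M b v - (d0 - 'i *: d1)) *m M =
     (- 'i * 2) *: ('i *: (der_along_M b v *m M) - 2 *: a).
    rewrite mulmxBl mulmxBl -!scalemxAl d0M d1M.
    move: (_ *m M) (a) => c a'; apply/rowP => l; rewrite !mxE; ring: i2.
  rewrite typeP EE; split=> [/eqP|->]; last by rewrite subrr scaler0.
  rewrite scalemx_eq0 mulf_eq0 oppr_eq0 (negPf n2) (negPf (im_neq0 R)) /=.
  by rewrite subr_eq0 => /eqP.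
have E1 : drsubmx W = 0 <->
    cD (rshift n 0) b v + 'i * cD (rshift n 1) b v = 0.
  split=> [W0|E].
    have := congr1 (fun X : 'M[R[i]]_2 => X 0 1) W0; rewrite !mxE db1 => E.
    apply: (mulfI (im_neq0 R)); rewrite mulr0 -[RHS]E -/b.
    by rewrite mulrDr mulrA i2 mulN1r.
  have E' : cD (rshift n 1) b v = 'i * cD (rshift n 0) b v.
    by apply: (mulfI (im_neq0 R)); rewrite mulrA i2 mulN1r;
      apply/eqP; rewrite -addr_eq0 addrC E.
  apply/matrixP => j k; rewrite [RHS]mxE.
  by case: (ord2P j) => ->; case: (ord2P k) => ->;
     rewrite !mxE ?db1 -/b ?E' subrr.
split=> [[/E3 e3 /E2 e2 /E1 e1]|[/E1 e1 /E2 e2 /E3 e3]].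
  exact: And3 e1 e2 e3.
exact: And3 e3 e2 e1.
Qed.

(** * From a local potential to the equations *)

Lemma near_sphere_coord_neq0 (R : realType) n (v : 'rV[R]_(n + 2)) :
  sphere_coord v != 0 -> \forall y \near v, sphere_coord y != 0.
Proof.
have coord (k : 'I_(n + 2)) : v 0 k != 0 ->
    \forall y \near v, (y : 'rV[R]_(n + 2)) 0 k != 0.
  move=> vk.
  have c : {for v, continuous (fun y : 'rV[R]_(n + 2) => y 0 k)}.
    exact: coord_continuous.
  have : \forall x \near v 0 k, x != 0.
    by apply: open_nbhs_nbhs; split => //; exact: open_neq.
  exact: c.
rewrite eq_complex /= negb_and => /orP[] /coord; apply: filterS => y yk.
  by rewrite eq_complex /= (negPf yk).
by rewrite eq_complex /= (negPf yk) andbF.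
Qed.

Lemma sphere_coord_line (R : realType) n (v : 'rV[R]_(n + 2)) (t : R) :
  sphere_coord (t *: delta_mx 0 (rshift n 0) + v) = t%:C + sphere_coord v.
Proof.
rewrite /sphere_coord !mxE !eqxx eq_rshift /=.
by apply/eqP; rewrite eq_complex /= mulr1 mulr0 add0r !eqxx.
Qed.

Lemma lsubmx_line (R : realType) n (v : 'rV[R]_(n + 2)) j (t : R) :
  lsubmx (t *: delta_mx 0 (rshift n j) + v) = lsubmx v.
Proof.
by apply/rowP => l; rewrite !mxE eq_lrshift andbF mulr0 add0r.
Qed.

Lemma near_line (R : realType) N (V : set 'rV[R]_N) v w : open V -> V v ->
  \forall t \near (0 : R), V (t *: w + v).
Proof.
move=> oV Vv; have nV : nbhs v V by exact: open_nbhs_nbhs.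
exact: (line_cvg w nV).
Qed.

(** The points with non-zero coordinate are dense in each sphere. *)
Lemma eq0_off_zero (R : realType) n (V : set 'rV[R]_(n + 2))
    (H : 'rV[R]_(n + 2) -> R[i]) v : open V -> V v -> cdiff H v ->
  (forall y, V y -> lsubmx y = lsubmx v -> sphere_coord y != 0 -> H y = 0) ->
  H v = 0.
Proof.
move=> oV Vv dH H0; have [v0|v0] := eqVneq (sphere_coord v) 0; last exact: H0.
apply: (@cdiff_eq0_punctured_line _ _ _ _ (delta_mx 0 (rshift n 0)) dH).
rewrite near_withinE; apply: filterS (near_line (delta_mx 0 (rshift n 0)) oV Vv).
move=> t Vt t0; apply: H0 => //; first exact: lsubmx_line.
by rewrite sphere_coord_line v0 addr0 eq_complex /= negb_and t0.
Qed.

Lemma cD_coord_mul (R : realType) n (c : R[i]) (b : 'rV[R]_(n + 2) -> R[i]) v j :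
  cdiff b v ->
  cD j (fun y => c * sphere_coord y * b y) v =
  c * (cD j (@sphere_coord R n) v * b v + sphere_coord v * cD j b v).
Proof.
move=> db; have Z := sphere_coord_cdiff v; have dc := cdiff_cst c v.
rewrite (cDM _ (cdiffM dc Z) db) (cDM _ dc Z) cD_cst; ring.
Qed.

Lemma der_along_M_coord_mul (R : realType) n (c : R[i])
    (b : 'rV[R]_(n + 2) -> R[i]) v : cdiff b v ->
  der_along_M (fun y => c * sphere_coord y * b y) v =
  (c * sphere_coord v) *: der_along_M b v.
Proof.
move=> db; apply/rowP => l.
by rewrite !mxE cD_coord_mul // cD_sphere_coordl mul0r add0r mulrA.
Qed.

Lemma dbar_coord_mul (R : realType) n (c : R[i])
    (b : 'rV[R]_(n + 2) -> R[i]) v : cdiff b v ->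
  let F := fun y => c * sphere_coord y * b y in
  cD (rshift n 0) F v + 'i * cD (rshift n 1) F v =
  c * sphere_coord v * (cD (rshift n 0) b v + 'i * cD (rshift n 1) b v).
Proof.
move=> db F; rewrite !cD_coord_mul // cD_sphere_coord0 cD_sphere_coord1.
have key (i z x d0 d1 : R[i]) : i * i = -1 ->
    c * (1 * x + z * d0) + i * (c * (i * x + z * d1)) = c * z * (d0 + i * d1).
  by move=> i2; ring: i2.
exact: key (sqr_im R).
Qed.

(** The formula for the 1-form in terms of the potential F, known where the
    sphere coordinate is non-zero, gives the three equations of
    [fiber11_pointwise], including where the coordinate vanishes.  The family
    K1, K2, K3 is attached to the fibre through v, so the formula for the
    M-part is only assumed on that fibre. *)
Lemma potential_equations (R : realType) n (V : set 'rV[R]_(n + 2))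
    (G : 'rV[R]_(n + 2) -> 'rV[R[i]]_(n + 2)) (F : 'rV[R]_(n + 2) -> R[i])
    (K1 K2 K3 : 'M[R[i]]_n) (s : R[i]) v :
  open V -> V v -> s != 0 ->
  (forall k, csmooth V (fun y => G y 0 k)) ->
  (forall y, V y -> sphere_coord y != 0 ->
     F y = 'i * s * sphere_coord y * G y 0 (rshift n 0)) ->
  (forall y, V y -> sphere_coord y != 0 ->
     cD (rshift n 0) F y + 'i * cD (rshift n 1) F y = 0) ->
  (forall y, V y -> lsubmx y = lsubmx v -> sphere_coord y != 0 ->
     (2 * s * sphere_coord y) *: lsubmx (G y) =
       der_along_M F y *m null_quat K1 K2 K3 'i s (sphere_coord y)) ->
  let b := fun y => G y 0 (rshift n 0) in
  [/\ cD (rshift n 0) b v + 'i * cD (rshift n 1) b v = 0,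
      2 *: lsubmx (G v) =
        'i *: (der_along_M b v *m null_quat K1 K2 K3 'i s (sphere_coord v)) &
      Mpart_der G (rshift n 0) v + 'i *: Mpart_der G (rshift n 1) v = 0].
Proof.
move=> oV Vv s0 sG FE Fbar FG b.
have i2 := sqr_im R; have n2 := two_neq0 R; have i0 := im_neq0 R.
have db y : V y -> cdiff b y by move=> Vy; exact: csmooth_cdiff (sG _) Vy.
have dG k y : V y -> cdiff (fun y => G y 0 k) y
  by move=> Vy; exact: csmooth_cdiff (sG k) Vy.
have sDb j : csmooth V (cD j b) by exact: csmooth_cD (sG _).
have dDb j y : V y -> cdiff (cD j b) y by move=> Vy; exact: csmooth_cdiff (sDb j) Vy.
have nearF y : V y -> sphere_coord y != 0 ->
    \forall y' \near y, F y' = 'i * s * sphere_coord y' * b y'.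
  move=> Vy y0.
  apply: filterS (filterI (open_nbhs_nbhs (conj oV Vy))
                          (near_sphere_coord_neq0 y0)).
  by move=> y' [Vy' y'0]; exact: FE.
have E1 y : V y -> cD (rshift n 0) b y + 'i * cD (rshift n 1) b y = 0.
  move=> Vy; pose H y' := cD (rshift n 0) b y' + 'i * cD (rshift n 1) b y'.
  have dH : cdiff H y.
    apply: cdiffD; first exact: dDb.
    by apply: cdiffM; [exact: cdiff_cst|exact: dDb].
  apply: (eq0_off_zero oV Vy dH) => y' Vy' _ y'0.
  have := Fbar _ Vy' y'0.
  rewrite !(cD_near _ (nearF _ Vy' y'0)) dbar_coord_mul; last exact: db.
  move=> /eqP; rewrite mulf_eq0 mulf_eq0 mulf_eq0 (negPf i0) (negPf s0).
  by rewrite (negPf y'0) /= => /eqP.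
have E2 y : V y -> lsubmx y = lsubmx v -> 2 *: lsubmx (G y) =
    'i *: (der_along_M b y *m null_quat K1 K2 K3 'i s (sphere_coord y)).
  move=> Vy yv; apply/rowP => l; rewrite !mxE; apply/eqP; rewrite -subr_eq0.
  pose H y' := 2 * G y' 0 (lshift 2 l) + - 'i * \sum_k cD (lshift 2 k) b y' *
    null_quat K1 K2 K3 'i s (sphere_coord y') k l.
  have HE y' : H y' = (2 *: lsubmx (G y') -
      'i *: (der_along_M b y' *m null_quat K1 K2 K3 'i s (sphere_coord y'))) 0 l.
    rewrite !mxE /H mulNr; congr (_ - _ * _).
    by apply: eq_bigr => k _; rewrite !mxE.
  suff : H y = 0 by rewrite HE !mxE => ->.
  have dH : cdiff H y.
    apply: cdiffD; apply: cdiffM; try exact: cdiff_cst; first exact: dG.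
    apply: cdiff_sum => k; apply: cdiffM; first exact: dDb.
    exact: null_quat_cdiff.
  apply: (eq0_off_zero oV Vy dH) => y' Vy' y'y y'0.
  have := FG _ Vy' (etrans y'y yv) y'0.
  have -> : der_along_M F y' = der_along_M (fun y' => 'i * s * sphere_coord y' * b y') y'.
    by apply/rowP => k; rewrite !mxE; apply: cD_near; exact: nearF.
  rewrite der_along_M_coord_mul; last exact: db.
  rewrite HE -scalemxAl => E.
  have c0 : s * sphere_coord y' != 0 by rewrite mulf_neq0.
  have {}E : 2 *: lsubmx (G y') =
      'i *: (der_along_M b y' *m null_quat K1 K2 K3 'i s (sphere_coord y')).
    apply: (scalerI c0); rewrite !scalerA [_ * 2]mulrC [2 * _]mulrA E.
    by rewrite [_ * 'i]mulrC [_ * (s * _)]mulrA.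
  by rewrite E subrr mxE.
split; [exact: E1|exact: E2|].
(* differentiate the second equation along the sphere, inside the fibre *)
have Dj (j : 'I_2) l : 2 * cD (rshift n j) (fun y => G y 0 (lshift 2 l)) v =
  'i * \sum_k (cD (rshift n j) (cD (lshift 2 k) b) v *
                 null_quat K1 K2 K3 'i s (sphere_coord v) k l +
               cD (lshift 2 k) b v * (cD (rshift n j) (@sphere_coord R n) v *
                 null_quat_der K1 K2 K3 'i s (sphere_coord v) k l)).
  have dN k := null_quat_cdiff K1 K2 K3 'i s k l v.
  transitivity (cD (rshift n j) (fun y => 2 * G y 0 (lshift 2 l)) v).
    rewrite (cDM _ (cdiff_cst _ _) (dG _ _ Vv)) cD_cst.
    by rewrite mul0r add0r.
  transitivity (cD (rshift n j) (fun y => 'i * \sum_k cD (lshift 2 k) b y *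
      null_quat K1 K2 K3 'i s (sphere_coord y) k l) v).
    apply: cD_line; have nV := near_line (delta_mx 0 (rshift n j)) oV Vv.
    apply: filterS nV => t Vt; have := congr1 (fun X : 'rV[R[i]]_n => X 0 l)
      (E2 _ Vt (lsubmx_line _ _ _)).
    rewrite !mxE => ->; congr (_ * _).
    by apply: eq_bigr => k _; rewrite !mxE.
  rewrite (cDM _ (cdiff_cst _ _) (cdiff_sum _ (fun k => cdiffM (dDb _ _ Vv) (dN k)))).
  rewrite cD_cst mul0r add0r (cD_sum _ _ (fun k => cdiffM (dDb _ _ Vv) (dN k))).
  congr (_ * _); apply: eq_bigr => k _.
  by rewrite (cDM _ (dDb _ _ Vv) (dN k)) cD_null_quat.
(* d_M and dbar commute, and dbar b vanishes in a neighbourhood *)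
have comm k : cD (rshift n 0) (cD (lshift 2 k) b) v +
    'i * cD (rshift n 1) (cD (lshift 2 k) b) v = 0.
  rewrite (cD_comm (rshift n 0) (lshift 2 k) oV (sG _) Vv).
  rewrite (cD_comm (rshift n 1) (lshift 2 k) oV (sG _) Vv).
  transitivity (cD (lshift 2 k) (fun y => cD (rshift n 0) b y +
     'i * cD (rshift n 1) b y) v).
    rewrite (cDD _ (dDb _ _ Vv) (cdiffM (cdiff_cst _ _) (dDb _ _ Vv))).
    by rewrite (cDM _ (cdiff_cst _ _) (dDb _ _ Vv)) cD_cst mul0r add0r.
  rewrite -(cD_cst 0 (lshift 2 k) v).
  by apply: cD_near; apply: filterS (open_nbhs_nbhs (conj oV Vv)) => y; exact: E1.
apply/rowP => l; rewrite !mxE; apply: (mulfI n2).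
rewrite mulr0 mulrDr mulrCA !Dj cD_sphere_coord0 cD_sphere_coord1.
rewrite !mulr_sumr -big_split /= big1 // => k _.
have Ek : cD (rshift n 0) (cD (lshift 2 k) b) v =
    - ('i * cD (rshift n 1) (cD (lshift 2 k) b) v).
  by apply/eqP; rewrite -addr_eq0 comm.
have key (i x p q r : R[i]) : i * i = -1 ->
    i * (- (i * x) * p + q * (1 * r)) + i * (i * (x * p + q * (i * r))) = 0.
  by move=> ii; ring: ii.
by rewrite Ek; exact: key i2.
Qed.

(** * The two charts of the sphere *)

(** The chart around the point at infinity is the one around 0 for the triple
    (I1, - I2, - I3). *)
Definition chart_sign (R : realType) (s : bool) : R := if s then 1 else -1.

Definition chart_zeta (R : realType) (s : bool) (u : @S2 R) : R[i] :=
  if s then zeta u else zeta_inv u.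

Lemma chart_signM (R : realType) s : chart_sign R s * chart_sign R s = 1.
Proof. by case: s; rewrite /chart_sign; ring. Qed.

Lemma sphere_eq (R : realType) (u : @S2 R) :
  sx1 u ^+ 2 + sx2 u ^+ 2 + sx3 u ^+ 2 = 1.
Proof. by have /set_mem := valP u. Qed.

Lemma S2_cdomP (R : realType) s (u : @S2 R) :
  cdom (@S2_atlas R s) u <-> 1 + chart_sign R s * sx3 u != 0.
Proof.
case: s; rewrite /= /chart_sign.
  by rewrite mul1r addrC addr_eq0.
by rewrite mulN1r subr_eq0 eq_sym.
Qed.

Lemma chart_zetaRe (R : realType) s (u : @S2 R) :
  complex.Re (chart_zeta s u) = - sx1 u / (1 + chart_sign R s * sx3 u).
Proof. by case: s; rewrite /= /chart_sign ?mul1r ?mulN1r mulNr. Qed.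

Lemma chart_zetaIm (R : realType) s (u : @S2 R) :
  complex.Im (chart_zeta s u) =
  - (chart_sign R s * sx2 u) / (1 + chart_sign R s * sx3 u).
Proof.
by case: s; rewrite /= /chart_sign ?mul1r ?mulN1r ?mulNr // opprK.
Qed.

Lemma complex_ext (R : realType) (z w : R[i]) :
  complex.Re z = complex.Re w -> complex.Im z = complex.Im w -> z = w.
Proof. by case: z => a b; case: w => c d /= -> ->. Qed.

Lemma chart_zetaE (R : realType) s (u : @S2 R) :
  cdom (@S2_atlas R s) u -> chart_zeta s u =
  - ((sx1 u)%:C + (chart_sign R s)%:C * 'i * (sx2 u)%:C) /
    (1 + (chart_sign R s)%:C * (sx3 u)%:C).
Proof.
move=> /S2_cdomP u3.
have -> : 1 + (chart_sign R s)%:C * (sx3 u)%:C =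
    (1 + chart_sign R s * sx3 u)%:C by rewrite rmorphD rmorph1 rmorphM.
have nz : (1 + chart_sign R s * sx3 u)%:C != 0 by rewrite eq_complex /= negb_and u3.
apply: (mulIf nz); rewrite divfK //.
apply: complex_ext; rewrite ?cReM ?cImM chart_zetaRe chart_zetaIm /=.
  by rewrite mulr0 subr0 divfK //; ring.
by rewrite mulr0 add0r divfK //; ring.
Qed.

Lemma S2_cmapE (R : realType) s (u : @S2 R) :
  cmap (@S2_atlas R s) u = row_of_complex (chart_zeta s u).
Proof. by case: s. Qed.

Lemma S2_ext (R : realType) (u v : @S2 R) :
  sx1 u = sx1 v -> sx2 u = sx2 v -> sx3 u = sx3 v -> u = v.
Proof.
rewrite /sx1 /sx2 /sx3 => e1 e2 e3; apply/val_inj.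
by move: (\val u) (\val v) e1 e2 e3 => [[a b] c] [[a' b'] c'] /= -> -> ->.
Qed.

Lemma S2_cinvE (R : realType) s (v : 'rV[R]_2) :
  [/\ sx1 (cinv (@S2_atlas R s) v) =
        - 2 * v 0 0 / (1 + v 0 0 ^+ 2 + v 0 1 ^+ 2),
      sx2 (cinv (@S2_atlas R s) v) =
        - 2 * (chart_sign R s * v 0 1) / (1 + v 0 0 ^+ 2 + v 0 1 ^+ 2) &
      sx3 (cinv (@S2_atlas R s) v) =
        chart_sign R s * (1 - v 0 0 ^+ 2 - v 0 1 ^+ 2) /
          (1 + v 0 0 ^+ 2 + v 0 1 ^+ 2)].
Proof.
by case: s; split; rewrite /chart_sign /sx1 /sx2 /sx3 /= ?sqrrN ?mul1r ?mulN1r.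
Qed.

(** The denominator of the stereographic projection. *)
Lemma one_sum_sqr_neq0 (R : realType) (a b : R) : 1 + a ^+ 2 + b ^+ 2 != 0.
Proof.
by apply: lt0r_neq0; have := sqr_ge0 a; have := sqr_ge0 b; lra.
Qed.

Lemma S2_cdom_cinv (R : realType) s (v : 'rV[R]_2) :
  cdom (@S2_atlas R s) (cinv (@S2_atlas R s) v).
Proof.
apply/S2_cdomP; have [_ _ ->] := S2_cinvE s v.
have nz := one_sum_sqr_neq0 (v 0 0) (v 0 1).
rewrite !mulrA chart_signM mul1r.
have -> : 1 + (1 - v 0 0 ^+ 2 - v 0 1 ^+ 2) / (1 + v 0 0 ^+ 2 + v 0 1 ^+ 2) =
  2 / (1 + v 0 0 ^+ 2 + v 0 1 ^+ 2) by field.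
by rewrite mulf_neq0 ?invr_neq0 // pnatr_eq0.
Qed.

Lemma S2_cinvK (R : realType) s (v : 'rV[R]_2) :
  cmap (@S2_atlas R s) (cinv (@S2_atlas R s) v) = v.
Proof.
have nz := one_sum_sqr_neq0 (v 0 0) (v 0 1).
have s2 := chart_signM R s.
have [e1 e2 e3] := S2_cinvE s v.
rewrite S2_cmapE /row_of_complex; apply/rowP => j; rewrite mxE.
rewrite chart_zetaRe chart_zetaIm e1 e2 e3 !mulrA s2 !mul1r.
have E : 1 + (1 - v 0 0 ^+ 2 - v 0 1 ^+ 2) / (1 + v 0 0 ^+ 2 + v 0 1 ^+ 2) =
  2 / (1 + v 0 0 ^+ 2 + v 0 1 ^+ 2) by field.
have n2 : 2 != 0 :> R by rewrite pnatr_eq0.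
rewrite E; case: (ord2P j) => -> /=.
  by field; rewrite ?nz ?n2.
transitivity (chart_sign R s * chart_sign R s * v 0 1); last by rewrite s2 mul1r.
by field; rewrite ?nz ?n2.
Qed.

Lemma S2_cmapK (R : realType) s (u : @S2 R) : cdom (@S2_atlas R s) u ->
  cinv (@S2_atlas R s) (cmap (@S2_atlas R s) u) = u.
Proof.
move=> /S2_cdomP u3; have s2 := chart_signM R s.
have [e1 e2 e3] := S2_cinvE s (cmap (@S2_atlas R s) u).
have v0 : cmap (@S2_atlas R s) u 0 0 = - sx1 u / (1 + chart_sign R s * sx3 u).
  by rewrite S2_cmapE mxE /= chart_zetaRe.
have v1 : cmap (@S2_atlas R s) u 0 1 =
    - (chart_sign R s * sx2 u) / (1 + chart_sign R s * sx3 u).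
  by rewrite S2_cmapE mxE /= chart_zetaIm.
rewrite v0 v1 in e1 e2 e3.
have u12 : sx1 u ^+ 2 + sx2 u ^+ 2 = 1 - sx3 u ^+ 2.
  by rewrite -(sphere_eq u) addrK.
have r2 : 1 + (- sx1 u / (1 + chart_sign R s * sx3 u)) ^+ 2 +
    (- (chart_sign R s * sx2 u) / (1 + chart_sign R s * sx3 u)) ^+ 2 =
    2 / (1 + chart_sign R s * sx3 u).
  transitivity (((1 + chart_sign R s * sx3 u) ^+ 2 + (sx1 u ^+ 2 +
      chart_sign R s * chart_sign R s * sx2 u ^+ 2)) /
      (1 + chart_sign R s * sx3 u) ^+ 2); first by field.
  rewrite s2 mul1r u12.
  have -> : (1 + chart_sign R s * sx3 u) ^+ 2 + (1 - sx3 u ^+ 2) =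
    2 * (1 + chart_sign R s * sx3 u) by ring: s2.
  by field.
have n2 : 2 != 0 :> R by rewrite pnatr_eq0.
apply: S2_ext.
- by rewrite e1 r2; field; rewrite ?u3 ?n2.
- rewrite e2 r2.
  transitivity (chart_sign R s * chart_sign R s * sx2 u); last by rewrite s2 mul1r.
  by field; rewrite ?u3 ?n2.
- rewrite e3 r2.
  set d := 1 + _ in u3 r2 *; set a := _ ^+ 2 in r2 *; set b := _ ^+ 2 in r2 *.
  have -> : 1 - a - b = 2 - 2 / d by rewrite -r2; ring.
  transitivity (chart_sign R s * (d - 1)); first by field; rewrite ?u3 ?n2.
  by rewrite /d addrC addKr mulrA s2 mul1r.
Qed.

Lemma pair_continuous (V U W : topologicalType) (f : V -> U) (g : V -> W) v :
  {for v, continuous f} -> {for v, continuous g} ->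
  {for v, continuous (fun y => (f y, g y))}.
Proof. by move=> cf cg; apply: cvg_pair; [exact: cf|exact: cg]. Qed.

Lemma S2_cinv_continuous (R : realType) s : continuous (cinv (@S2_atlas R s)).
Proof.
apply: (@continuous_comp_initial _ _ _ (@set_val _ (@sphere R))) => v.
have c k : {for v, continuous (fun y : 'rV[R]_2 => y 0 k)}.
  exact: coord_continuous.
have cM (f g : 'rV[R]_2 -> R) : {for v, continuous f} -> {for v, continuous g} ->
    {for v, continuous (fun y => f y * g y)} by exact: continuousM.
have cD' (f g : 'rV[R]_2 -> R) : {for v, continuous f} -> {for v, continuous g} ->
    {for v, continuous (fun y => f y + g y)} by exact: continuousD.
have cC (x : R) : {for v, continuous (fun _ : 'rV[R]_2 => x)}
  by exact: cst_continuous.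
have c2 k : {for v, continuous (fun y : 'rV[R]_2 => y 0 k ^+ 2)} := cM _ _ (c k) (c k).
have cN k : {for v, continuous (fun y : 'rV[R]_2 => - y 0 k ^+ 2)}.
  exact: continuousN (c2 k).
have cden : {for v, continuous (fun y : 'rV[R]_2 =>
    (1 + y 0 0 ^+ 2 + y 0 1 ^+ 2)^-1)}.
  apply: (@continuousV _ _ (fun y : 'rV[R]_2 => 1 + y 0 0 ^+ 2 + y 0 1 ^+ 2)).
    exact: one_sum_sqr_neq0.
  exact: cD' (cD' _ _ (cC 1) (c2 0)) (c2 1).
have c1 : {for v, continuous (fun y => sx1 (cinv (@S2_atlas R s) y))}.
  have -> : (fun y => sx1 (cinv (@S2_atlas R s) y)) =
    (fun y => - 2 * y 0 0 / (1 + y 0 0 ^+ 2 + y 0 1 ^+ 2)).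
    by apply/funext => y; have [] := S2_cinvE s y.
  exact: cM (cM _ _ (cC _) (c 0)) cden.
have c2' : {for v, continuous (fun y => sx2 (cinv (@S2_atlas R s) y))}.
  have -> : (fun y => sx2 (cinv (@S2_atlas R s) y)) =
    (fun y => - 2 * (chart_sign R s * y 0 1) / (1 + y 0 0 ^+ 2 + y 0 1 ^+ 2)).
    by apply/funext => y; have [] := S2_cinvE s y.
  exact: cM (cM _ _ (cC _) (cM _ _ (cC _) (c 1))) cden.
have c3 : {for v, continuous (fun y => sx3 (cinv (@S2_atlas R s) y))}.
  have -> : (fun y => sx3 (cinv (@S2_atlas R s) y)) =
    (fun y => chart_sign R s * (1 - y 0 0 ^+ 2 - y 0 1 ^+ 2) /
       (1 + y 0 0 ^+ 2 + y 0 1 ^+ 2)).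
    by apply/funext => y; have [] := S2_cinvE s y.
  exact: cM (cM _ _ (cC _) (cD' _ _ (cD' _ _ (cC 1) (cN 0)) (cN 1))) cden.
have E : set_val \o cinv (@S2_atlas R s) = (fun y =>
  ((sx1 (cinv (@S2_atlas R s) y), sx2 (cinv (@S2_atlas R s) y)),
    sx3 (cinv (@S2_atlas R s) y))).
  by apply/funext => y /=; case: (cinv _ y) => [[[? ?] ?] ?].
rewrite E; exact: (pair_continuous (pair_continuous c1 c2') c3).
Qed.

Lemma S2_cdom_flip (R : realType) s (u : @S2 R) :
  chart_zeta s u != 0 -> cdom (@S2_atlas R (~~ s)) u.
Proof.
move=> z0; apply/S2_cdomP; apply: contra z0 => /eqP u0.
have sE : chart_sign R (~~ s) = - chart_sign R s.
  by case: s {u0} => //=; rewrite /chart_sign /= opprK.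
(* outside of the other chart only the pole with coordinate 0 remains *)
have u3 : sx3 u ^+ 2 = 1.
  have E : chart_sign R s * sx3 u = 1.
    by apply/eqP; rewrite -subr_eq0 -oppr_eq0 opprB -mulNr -sE u0.
  by rewrite -[RHS]mul1r -{1}E -E; ring: (chart_signM R s).
have : sx1 u ^+ 2 + sx2 u ^+ 2 == 0.
  by have := sphere_eq u; rewrite u3 => /eqP; rewrite -subr_eq0 addrK.
rewrite paddr_eq0 ?sqr_ge0 // !sqrf_eq0 => /andP[/eqP x1 /eqP x2].
apply/eqP; apply: complex_ext.
  by rewrite chart_zetaRe x1 oppr0 mul0r.
by rewrite chart_zetaIm x2 mulr0 oppr0 mul0r.
Qed.

Lemma chart_zeta_flipM (R : realType) s (u : @S2 R) :
  cdom (@S2_atlas R s) u -> cdom (@S2_atlas R (~~ s)) u ->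
  chart_zeta s u * chart_zeta (~~ s) u = 1.
Proof.
wlog -> : s / s = true => [H c c'|].
  case: s c c' => c c'; first exact: H.
  by rewrite mulrC; exact: (H true).
move=> /S2_cdomP + /S2_cdomP; rewrite /chart_sign /= mul1r mulN1r => u1 u1'.
rewrite -[zeta u]/(chart_zeta true u) -[zeta_inv u]/(chart_zeta false u).
apply: complex_ext; rewrite ?cReM ?cImM !chart_zetaRe !chart_zetaIm /chart_sign.
  rewrite !mul1r !mulN1r /=.
  apply: (mulIf u1); apply: (mulIf u1').
  transitivity (sx1 u ^+ 2 + sx2 u ^+ 2); first by field; rewrite ?u1 ?u1'.
  by rewrite -[LHS](addrK (sx3 u ^+ 2)) sphere_eq; ring.
rewrite !mul1r !mulN1r /=.
by field; rewrite ?u1 ?u1'.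
Qed.

Lemma chart_zeta_flip (R : realType) s (u : @S2 R) :
  cdom (@S2_atlas R s) u -> chart_zeta s u != 0 ->
  chart_zeta (~~ s) u = (chart_zeta s u)^-1.
Proof.
move=> us z0; have zz := chart_zeta_flipM us (S2_cdom_flip z0).
by rewrite -[RHS]mulr1 -zz mulKf.
Qed.

Lemma zeta_chart_zeta (R : realType) s (u : @S2 R) :
  cdom (@S2_atlas R s) u -> chart_zeta s u != 0 ->
  zeta_Cstar u /\ zeta u = if s then chart_zeta s u else (chart_zeta s u)^-1.
Proof.
case: s => u3 z0; first by [].
have E : zeta u = (chart_zeta false u)^-1 := chart_zeta_flip u3 z0.
split=> //; split; last by rewrite E invr_eq0.
exact: (S2_cdom_flip z0).
Qed.

Lemma zeta_Cstar_chart (R : realType) s (u : @S2 R) :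
  cdom (@S2_atlas R s) u -> zeta_Cstar u -> chart_zeta s u != 0.
Proof.
case: s => [_ []//|us [ut _]]; apply/eqP => u0.
have := chart_zeta_flipM us ut; rewrite u0 mul0r => /eqP.
by rewrite eq_sym oner_eq0.
Qed.

(** * Change of chart on the sphere *)

Lemma cdiffV (R : realType) N (F : 'rV[R]_N -> R[i]) v :
  cdiff F v -> F v != 0 -> cdiff (fun y => (F y)^-1) v.
Proof.
move=> [Fr Fi] F0.
have E y : (F y)^-1 =
  (complex.Re (F y) / (complex.Re (F y) ^+ 2 + complex.Im (F y) ^+ 2)) +i*
  (- (complex.Im (F y) / (complex.Re (F y) ^+ 2 + complex.Im (F y) ^+ 2))).
  by case: (F y).
have den : differentiable (fun y =>
    (complex.Re (F y) ^+ 2 + complex.Im (F y) ^+ 2)^-1) v.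
  apply: (@differentiableV _ _ (fun y => complex.Re (F y) ^+ 2 + complex.Im (F y) ^+ 2)).
    exact: differentiableD (differentiableM Fr Fr) (differentiableM Fi Fi).
  move: F0; rewrite eq_complex /= negb_and => F0.
  by rewrite paddr_eq0 ?sqr_ge0 // !sqrf_eq0 negb_and.
split; under eq_fun do rewrite E /=.
  exact: differentiableM Fr den.
exact: differentiableN (differentiableM Fi den).
Qed.

(** The coordinate of the chart s', as a function of the coordinates of the
    chart s. *)
Definition sphere_transition (R : realType) n (s s' : bool)
    (y : 'rV[R]_(n + 2)) : R[i] :=
  chart_zeta s' (cinv (@S2_atlas R s) (rsubmx y)).

Lemma chart_zeta_cinv (R : realType) n s (y : 'rV[R]_(n + 2)) :
  chart_zeta s (cinv (@S2_atlas R s) (rsubmx y)) = sphere_coord y.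
Proof.
have E := S2_cinvK s (rsubmx y); rewrite S2_cmapE in E.
apply: complex_ext.
  have := congr1 (fun X : 'rV[R]_2 => X 0 0) E.
  by rewrite !mxE /=.
have := congr1 (fun X : 'rV[R]_2 => X 0 1) E.
by rewrite !mxE /=.
Qed.

Lemma sphere_transitionE (R : realType) n s s' (y : 'rV[R]_(n + 2)) :
  sphere_coord y != 0 -> sphere_transition s s' y =
  if s == s' then sphere_coord y else (sphere_coord y)^-1.
Proof.
move=> y0; rewrite /sphere_transition; case: eqP => [<-|/eqP ss'].
  exact: chart_zeta_cinv.
have -> : s' = ~~ s by move: ss'; case: s; case: s'.
rewrite chart_zeta_flip ?chart_zeta_cinv //; exact: S2_cdom_cinv.
Qed.

Lemma sphere_transition_refl (R : realType) n s :
  @sphere_transition R n s s = @sphere_coord R n.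
Proof. by apply/funext => y; exact: chart_zeta_cinv. Qed.

(** The complex derivative of the identity or of 1 / z. *)
Definition transition_slope (R : realType) (s s' : bool) (z : R[i]) : R[i] :=
  if s == s' then 1 else - (z ^+ 2)^-1.

(** For s <> s' the transition is 1 / zeta, which is holomorphic: hence a
    single complex slope.  The alternative in the hypothesis is the overlap of
    the two charts. *)
Lemma sphere_transition_der (R : realType) n s s' (v : 'rV[R]_(n + 2)) :
  s = s' \/ sphere_coord v != 0 ->
  cdiff (@sphere_transition R n s s') v /\
  forall j, cD j (@sphere_transition R n s s') v =
    cD j (@sphere_coord R n) v * transition_slope s s' (sphere_coord v).
Proof.
have Z := sphere_coord_cdiff v.
have refl : cdiff (@sphere_transition R n s s) v /\
  forall j, cD j (@sphere_transition R n s s) v =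
    cD j (@sphere_coord R n) v * transition_slope s s (sphere_coord v).
  rewrite sphere_transition_refl; split=> // j.
  by rewrite /transition_slope eqxx mulr1.
case=> [<- //|v0]; have [<- //|ss'] := eqVneq s s'.
have nE : \forall y \near v, (sphere_coord y)^-1 = sphere_transition s s' y.
  apply: filterS (near_sphere_coord_neq0 v0) => y y0.
  by rewrite sphere_transitionE // (negPf ss').
have ZV : cdiff (fun y => (@sphere_coord R n y)^-1) v by exact: cdiffV.
split.
  have [Zr Zi] := ZV; split.
    by apply: near_eq_differentiable Zr; apply: filterS nE => y ->.
  by apply: near_eq_differentiable Zi; apply: filterS nE => y ->.
move=> j; rewrite -(cD_near _ nE) /transition_slope (negPf ss').
have : cD j (fun y => sphere_coord y * (sphere_coord y)^-1) v = 0.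
  rewrite -[RHS](cD_cst 1 j v); apply: cD_near.
  by apply: filterS (near_sphere_coord_neq0 v0) => y y0; rewrite mulfV.
rewrite (cDM _ Z ZV) => E; apply: (mulfI v0).
move/eqP: E; rewrite addrC addr_eq0 => /eqP ->.
by rewrite expr2; field.
Qed.

Lemma differentiable_rV (R : realType) (V : normedModType R) N
    (T : V -> 'rV[R]_N) p :
  (forall k, differentiable (fun y => T y 0 k) p) -> differentiable T p.
Proof.
move=> dT.
have -> : T = \sum_(k < N) (fun y => T y 0 k *: delta_mx 0 k).
  by apply/funext => y; rewrite {1}[T y]row_sum_delta fct_sumE.
by apply: differentiable_sum => k; apply: differentiableZl; exact: dT.
Qed.

(** The Jacobian is defined through the differential of the whole map, which
    is only meaningful for a differentiable map. *)
Lemma jacE (R : realType) (X : topologicalType) N (c c' : chart R X N) z k l :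
  (forall k, differentiable (fun y => transition c c' y 0 k) (cmap c z)) ->
  jac c c' z k l = 'D_(delta_mx 0 l) (fun y => transition c c' y 0 k) (cmap c z).
Proof.
move=> dT; have dT' := differentiable_rV dT.
rewrite /jac mxE /jacobian /lin1_mx mxE -deriveE //.
by rewrite derive_mx ?mxE //; exact: diff_derivable.
Qed.

(** * Charts of the twistor space *)

Section TwistorCharts.
Context {R : realType} {m : nat} {M : topologicalType}.
Context {A : atlas R M (4 * m)} (hM : smooth_manifold A).
Local Notation n := (4 * m)%N.
Local Notation C := (twistor_atlas A).
Implicit Types (c : aidx C) (z : M * @S2 R) (y : 'rV[R]_(n + 2)).

Lemma twistor_cmap_lsubmx c z : lsubmx (cmap (C c) z) = cmap (A c.1) z.1.
Proof. by rewrite /= row_mxKl. Qed.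

Lemma twistor_cmap_sphere c z :
  sphere_coord (cmap (C c) z) = chart_zeta c.2 z.2.
Proof.
apply: complex_ext => /=; rewrite row_mxEr.
  by rewrite -/(cmap (@S2_atlas R c.2) z.2) S2_cmapE mxE.
by rewrite -/(cmap (@S2_atlas R c.2) z.2) S2_cmapE mxE.
Qed.

Lemma twistor_cmapK c z : cdom (C c) z -> cinv (C c) (cmap (C c) z) = z.
Proof.
move=> [z1 z2]; case: hM => _ _ chA _ _; have [_ _ cK _ _] := chA c.1.
rewrite [cinv _ _]surjective_pairing [RHS]surjective_pairing; congr (_, _) => /=.
  by rewrite row_mxKl cK.
by rewrite row_mxKr -/(cinv (@S2_atlas R c.2) _) S2_cmapK.
Qed.

Definition chart_image c (U : set (M * @S2 R)) : set 'rV[R]_(n + 2) :=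
  cmap (C c) @` (cdom (C c) `&` U).

(** The sphere charts are onto the plane, so only the coordinates of M are
    restricted. *)
Lemma chart_imageE c U y : chart_image c U y <->
  (cmap (A c.1) @` cdom (A c.1)) (lsubmx y) /\ U (cinv (C c) y).
Proof.
case: hM => _ _ chA _ _; have [_ _ cK _ _] := chA c.1.
split=> [[z [cz Uz] <-]|[[p cp py] Uy]].
  rewrite twistor_cmap_lsubmx twistor_cmapK //; split => //.
  by exists z.1 => //; case: cz.
exists (cinv (C c) y); last first.
  rewrite /= -py cK // py S2_cinvK; exact: hsubmxK.
split=> //; split=> /=; first by rewrite -py cK.
exact: S2_cdom_cinv.
Qed.

Lemma chart_image_cinv c U y : chart_image c U y ->
  [/\ cdom (C c) (cinv (C c) y), U (cinv (C c) y) &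
      cmap (C c) (cinv (C c) y) = y].
Proof. by move=> [z [cz Uz] <-]; rewrite twistor_cmapK. Qed.

Lemma chart_image_cmap c (U : set (M * @S2 R)) z : cdom (C c) z -> U z ->
  chart_image c U (cmap (C c) z).
Proof. by move=> cz Uz; exists z. Qed.

Lemma chart_image_open c U : open U -> open (chart_image c U).
Proof.
move=> oU; case: hM => _ _ chA _ _; have [_ oA _ _ cA] := chA c.1.
rewrite openE => y /chart_imageE[Ay Uy]; rewrite /interior /=.
have nA : \forall y' \near y, (cmap (A c.1) @` cdom (A c.1)) (lsubmx y').
  have cl : {for y, continuous (lsubmx : 'rV[R]_(n + 2) -> 'rV[R]_n)}.
    exact: continuous_lsubmx.
  exact: (cl _ (open_nbhs_nbhs (conj oA Ay))).
have cc : {for y, continuous (cinv (C c))}.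
  apply: pair_continuous.
    by apply: continuous_comp; [exact: continuous_lsubmx|exact: cA].
  by apply: continuous_comp; [exact: continuous_rsubmx|exact: S2_cinv_continuous].
have nU : \forall y' \near y, U (cinv (C c) y').
  exact: (cc _ (open_nbhs_nbhs (conj oU Uy))).
by apply: filterS (filterI nA nU) => y' ?; apply/chart_imageE.
Qed.

Lemma chart_image_line c y j t : chart_image c setT y ->
  chart_image c setT (t *: delta_mx 0 (rshift n j) + y).
Proof.
by move=> /chart_imageE[Ay _]; apply/chart_imageE; rewrite lsubmx_line.
Qed.

Lemma twistor_transition_sphere c c' y :
  transition (C c) (C c') y 0 (rshift n 0) =
    complex.Re (sphere_transition c.2 c'.2 y) /\
  transition (C c) (C c') y 0 (rshift n 1) =
    complex.Im (sphere_transition c.2 c'.2 y).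
Proof.
rewrite /transition /= !row_mxEr /sphere_transition.
rewrite -/(cmap (@S2_atlas R c'.2) _) -/(cinv (@S2_atlas R c.2) _).
by rewrite S2_cmapE !mxE.
Qed.

Lemma twistor_transition_base c c' y l :
  transition (C c) (C c') y 0 (lshift 2 l) =
    transition (A c.1) (A c'.1) (lsubmx y) 0 l.
Proof. by rewrite /transition /= row_mxEl. Qed.

Lemma transition_overlap c c' z : cdom (C c) z -> cdom (C c') z ->
  c.2 = c'.2 \/ sphere_coord (cmap (C c) z) != 0.
Proof.
move=> [_ cz] [_ cz']; have [->|cc'] := eqVneq c.2 c'.2; [by left|right].
have E : c'.2 = ~~ c.2 by move: cc'; case: c.2; case: c'.2.
rewrite E in cz'; have zz := chart_zeta_flipM cz cz'.
rewrite twistor_cmap_sphere; apply/eqP => z0; move/eqP: zz.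
by rewrite z0 mul0r eq_sym oner_eq0.
Qed.

Lemma twistor_transition_differentiable c c' z k :
  cdom (C c) z -> cdom (C c') z ->
  differentiable (fun y => transition (C c) (C c') y 0 k) (cmap (C c) z).
Proof.
move=> cz cz'; have := transition_overlap cz cz'.
move=> /sphere_transition_der[[dr di] _].
case: (split_ordP k) => [l ->|j ->].
  under eq_fun do rewrite twistor_transition_base.
  case: hM => _ _ _ _ /(_ c.1 c'.1 l 1%N)[dA _].
  apply: (@differentiable_comp _ _ _ _ lsubmx
    (fun x => transition (A c.1) (A c'.1) x 0 l)).
    exact: differentiable_lsubmx.
  rewrite twistor_cmap_lsubmx; apply: dA; exists z.1 => //.
  by case: cz; case: cz'.
case: (ord2P j) => ->.
  by under eq_fun do rewrite (twistor_transition_sphere c c' _).1.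
by under eq_fun do rewrite (twistor_transition_sphere c c' _).2.
Qed.

Lemma derive_line_const (V : normedModType R) (f : V -> R) (u v : V) :
  (forall t, f (t *: u + v) = f v) -> 'D_u f v = 0.
Proof.
move=> fc; rewrite derive_line.
have -> : (fun t : R => f (t *: u + v)) = cst (f v) by apply/funext => t.
by rewrite derive_cst.
Qed.

Lemma twistor_jac_sphere c c' z : cdom (C c) z -> cdom (C c') z ->
  (forall l, jac (C c) (C c') z (lshift 2 l) (rshift n 0) = 0) /\
  jac (C c) (C c') z (rshift n 0) (rshift n 0) +i*
  jac (C c) (C c') z (rshift n 1) (rshift n 0) =
    transition_slope c.2 c'.2 (sphere_coord (cmap (C c) z)).
Proof.
move=> cz cz'; have dT k := twistor_transition_differentiable k cz cz'.
have [_ Ds] := sphere_transition_der (transition_overlap cz cz').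
split=> [l|].
  rewrite jacE //; apply: derive_line_const => t.
  by rewrite !twistor_transition_base lsubmx_line.
rewrite !jacE // -[RHS]mul1r -(cD_sphere_coord0 (cmap (C c) z)) -Ds.
rewrite /cD; congr (_ +i* _); congr ('D__ _ _); apply/funext => y.
  exact: (twistor_transition_sphere c c' y).1.
exact: (twistor_transition_sphere c c' y).2.
Qed.

(** This number is the value of the 1-form on the rotation field zeta d/dzeta,
    which in the coordinate 1 / zeta only changes sign.  The part of the form
    along M does not contribute: the coordinates of M are constant along the
    sphere. *)
Lemma sphere_component_law c c' z (al : aidx C -> M * @S2 R -> 'rV[R[i]]_(n + 2)) :
  smooth_1form al -> cdom (C c) z -> cdom (C c') z ->
  al c' z 0 (rshift n 1) = 'i * al c' z 0 (rshift n 0) ->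
  (chart_sign R c.2)%:C * chart_zeta c.2 z.2 * al c z 0 (rshift n 0) =
  (chart_sign R c'.2)%:C * chart_zeta c'.2 z.2 * al c' z 0 (rshift n 0).
Proof.
move=> [_ law] cz cz' ali; have [J0 J1] := twistor_jac_sphere cz cz'.
have E : al c z 0 (rshift n 0) = al c' z 0 (rshift n 0) *
    transition_slope c.2 c'.2 (chart_zeta c.2 z.2).
  rewrite (law c c' z cz cz'); move: J0 J1; move: (jac _ _ _) => J J0 J1.
  rewrite mxE big_split_ord /= big1 ?add0r; last first.
    by move=> l _; rewrite mxE J0 mulr0.
  rewrite big_ord_recl big_ord_recl big_ord0 addr0.
  have -> : lift ord0 ord0 = 1 :> 'I_2 by exact/val_inj.
  rewrite !mxE ali -twistor_cmap_sphere -J1 [X in _ = _ * X]complexE.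
  by rewrite [RHS]mulrDr mulrA [_ * 'i]mulrC.
have := transition_overlap cz cz'; rewrite twistor_cmap_sphere E /transition_slope.
have [<- _|cc' [ccE|z0]] := eqVneq c.2 c'.2; first by rewrite mulr1.
  by move: cc'; rewrite ccE eqxx.
have sE : c'.2 = ~~ c.2 by move: cc'; case: c.2; case: c'.2.
case: cz => _ cz2; rewrite sE chart_zeta_flip //.
have -> : chart_sign R (~~ c.2) = - chart_sign R c.2.
  by case: c.2; rewrite /chart_sign /= ?opprK.
by rewrite rmorphN; field.
Qed.

End TwistorCharts.

(** * The potential on the twistor space *)

Section Potential.
Context {R : realType} {m : nat} {M : topologicalType}.
Context {A : atlas R M (4 * m)} (hM : smooth_manifold A) (h : hyperkahler A).
Local Notation n := (4 * m)%N.
Local Notation C := (twistor_atlas A).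
Implicit Types (c : aidx C) (z : M * @S2 R) (y : 'rV[R]_(n + 2)).

Definition cI1 a p : 'M[R[i]]_n := map_mx (real_complex R) (I1 h a p).
Definition cI2 a p : 'M[R[i]]_n := map_mx (real_complex R) (I2 h a p).
Definition cI3 a p : 'M[R[i]]_n := map_mx (real_complex R) (I3 h a p).

(** In the chart s, and for x the coordinate of a point of the sphere, this is
    2 s x I(zeta); see [I_zetaE]. *)
Definition twistor_null a p (s : bool) (x : R[i]) : 'M[R[i]]_n :=
  null_quat (cI1 a p) (cI2 a p) (cI3 a p) 'i (chart_sign R s)%:C x.

Lemma quat_triple_I a p : cdom (A a) p ->
  quat_triple (I1 h a p) (I2 h a p) (I3 h a p).
Proof. by move=> /(quaternionic h)[]. Qed.

Lemma quat_triple_cI a p : cdom (A a) p ->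
  quat_triple (cI1 a p) (cI2 a p) (cI3 a p).
Proof.
move=> /(quaternionic h)[e1 e2 e3 e123].
by split; rewrite -!map_mxM ?e1 ?e2 ?e3 ?e123 map_mxN map_mx1.
Qed.

Lemma I_sphere_sqr a p u : cdom (A a) p ->
  I_sphere h a p u *m I_sphere h a p u = - 1%:M.
Proof.
move=> /quat_triple_I K; rewrite -(quat_unit_sqr K (sphere_eq u)).
by rewrite /quat scale0r add0r.
Qed.

Lemma I_sphereE a p u : map_mx (real_complex R) (I_sphere h a p u) =
  quat (cI1 a p) (cI2 a p) (cI3 a p) 0 (sx1 u)%:C (sx2 u)%:C (sx3 u)%:C.
Proof.
by rewrite /quat scale0r add0r !map_mxD !map_mxZ.
Qed.

Lemma sphere_eqC (u : @S2 R) :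
  (sx1 u)%:C ^+ 2 + (sx2 u)%:C ^+ 2 + (sx3 u)%:C ^+ 2 = 1.
Proof. by rewrite -!rmorphXn -!rmorphD /= sphere_eq. Qed.

Lemma chart_signMC s : (chart_sign R s)%:C * (chart_sign R s)%:C = 1.
Proof. by rewrite -rmorphM chart_signM. Qed.

Lemma chart_sign_neq0 s : (chart_sign R s)%:C != 0.
Proof.
apply/eqP => s0; have := chart_signMC s; rewrite s0 mul0r => /eqP.
by rewrite eq_sym oner_eq0.
Qed.

Lemma S2_cdomC s (u : @S2 R) : cdom (@S2_atlas R s) u ->
  1 + (chart_sign R s)%:C * (sx3 u)%:C != 0.
Proof.
move=> /S2_cdomP u0; rewrite -rmorphM -[1]/(1%:C) -rmorphD eq_complex /=.
by rewrite negb_and u0.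
Qed.

Lemma I_zetaE a p s u : cdom (@S2_atlas R s) u -> chart_zeta s u != 0 ->
  (2 * (chart_sign R s)%:C * chart_zeta s u) *: I_zeta h a p (zeta u) =
  twistor_null a p s (chart_zeta s u).
Proof.
move=> us u0; have [_ ->] := zeta_chart_zeta us u0.
have n2 := two_neq0 R.
have -> : I_zeta h a p (if s then chart_zeta s u else (chart_zeta s u)^-1) =
  (2^-1 * (if s then chart_zeta s u else (chart_zeta s u)^-1)^-1) *:
     (cI1 a p + 'i *: cI2 a p) + cI3 a p -
  (2^-1 * (if s then chart_zeta s u else (chart_zeta s u)^-1)) *:
     (cI1 a p - 'i *: cI2 a p).
  by rewrite /I_zeta /I_plus /I_minus /I_zero !scalerN !scalerA
       ![2^-1 * _]mulrC.
apply/matrixP => k l; rewrite /twistor_null null_quatE !mxE.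
move: (cI1 a p k l) (cI2 a p k l) (cI3 a p k l) (chart_zeta s u) u0.
move=> x1 x2 x3 w w0; case: s {us}; rewrite /chart_sign.
  by rewrite rmorph1; field; rewrite ?n2 ?w0.
by rewrite rmorphN1; field; rewrite ?n2 ?w0.
Qed.

Lemma form10_parts al c z : form10 h al -> cdom (C c) z ->
  lsubmx (al c z) *m twistor_null c.1 z.1 c.2 (chart_zeta c.2 z.2) = 0 /\
  al c z 0 (rshift n 1) = 'i * al c z 0 (rshift n 0).
Proof.
move=> [_ type] cz; have := type c z cz; case: cz => cz1 cz2.
rewrite /type10 /part01 /twistor_J proj01_block.
rewrite -{1}[al c z]hsubmxK mul_row_block !mulmx0 addr0 add0r.
rewrite -row_mx0 => /eq_row_mx[aQ bQ]; split.
  move/proj01_eq0: aQ; rewrite I_sphereE chart_zetaE //.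
  by move/(eigenform_null_quat (quat_triple_cI cz1) (sqr_im R) (chart_signMC c.2)
    (two_neq0 R) _ (sphere_eqC z.2) (S2_cdomC cz2)).
have := congr1 (fun X : 'rV[R[i]]_2 => X 0 1) ((proj01_eq0 _ _).1 bQ).
have [_ ->] := mul_J_CP1 (rsubmx (al c z)) 0.
rewrite !mxE => E; apply: (mulfI (im_neq0 R)); rewrite -E mulrA sqr_im.
by rewrite mulN1r.
Qed.

Definition local_rep (al : aidx C -> M * @S2 R -> 'rV[R[i]]_(n + 2)) c y :=
  al c (cinv (C c) y).

Lemma local_rep_csmooth al c k : form10 h al ->
  csmooth (chart_image c setT) (fun y => local_rep al c y 0 k).
Proof.
move=> [[sal _] _]; have [sr si] := sal c k.
by split; [have := sr c|have := si c]; rewrite setIid /chart_image setIT.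
Qed.

Lemma local_rep_null al c z y : form10 h al -> cdom (C c) z ->
  chart_image c setT y -> lsubmx y = lsubmx (cmap (C c) z) ->
  lsubmx (local_rep al c y) *m twistor_null c.1 z.1 c.2 (sphere_coord y) = 0.
Proof.
move=> hal cz Vy yz; have [cy _ yE] := chart_image_cinv hM Vy.
have [aN _] := form10_parts hal cy.
have E : z.1 = (cinv (C c) y).1.
  by rewrite -{1}(twistor_cmapK hM cz) /= yz.
by rewrite E -[in sphere_coord y]yE twistor_cmap_sphere.
Qed.

(** The equations dbar b = 0, 2 a = i (d_M b) N and dbar a = 0 of
    [fiber11_pointwise] for the local representative of the 1-form. *)
Definition potential_eqs al c z : Prop :=
  let G := local_rep al c in let v := cmap (C c) z in
  let b := fun y => G y 0 (rshift n 0) in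
  [/\ cD (rshift n 0) b v + 'i * cD (rshift n 1) b v = 0,
      2 *: lsubmx (G v) = 'i *: (der_along_M b v *m
                             twistor_null c.1 z.1 c.2 (sphere_coord v)) &
      Mpart_der G (rshift n 0) v + 'i *: Mpart_der G (rshift n 1) v = 0].

Lemma fiber_form11_potential_eqs al c z : form10 h al -> cdom (C c) z ->
  [/\ type11 (twistor_J h c z) (dbar h al c z),
      ursubmx (dbar h al c z) = 0, dlsubmx (dbar h al c z) = 0 &
      drsubmx (dbar h al c z) = 0] <-> potential_eqs al c z.
Proof.
move=> hal cz; have [cz1 cz2] := cz.
have Vz : chart_image c setT (cmap (C c) z) by exact: chart_image_cmap.
have oV := @chart_image_open _ _ _ _ hM c _ openT.
apply: (@fiber11_pointwise R n (I_sphere h c.1 z.1 z.2) (cI1 c.1 z.1)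
  (cI2 c.1 z.1) (cI3 c.1 z.1) (chart_sign R c.2)%:C (sx1 z.2)%:C (sx2 z.2)%:C
  (sx3 z.2)%:C (local_rep al c) (cmap (C c) z)).
- exact: I_sphere_sqr.
- exact: quat_triple_cI.
- exact: chart_signMC.
- exact: I_sphereE.
- exact: sphere_eqC.
- exact: S2_cdomC.
- by rewrite twistor_cmap_sphere chart_zetaE.
- by move=> k; exact: csmooth_cdiff (local_rep_csmooth c k hal) Vz.
- apply: filterS (open_nbhs_nbhs (conj oV Vz)) => y Vy.
  have [cy _ _] := chart_image_cinv hM Vy.
  by have [_ ->] := form10_parts hal cy.
- move=> j t; apply: local_rep_null => //; last exact: lsubmx_line.
  exact: chart_image_line.
Qed.

Lemma dzetaE c z k : cdom (C c) z -> chart_zeta c.2 z.2 != 0 ->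
  dzeta c z 0 k = cD k (@sphere_coord R n) (cmap (C c) z) *
    transition_slope c.2 true (chart_zeta c.2 z.2).
Proof.
move=> cz z0; rewrite mxE -twistor_cmap_sphere.
rewrite -twistor_cmap_sphere in z0.
by have [_ <-] := sphere_transition_der (s := c.2) (s' := true) (or_intror z0).
Qed.

(** This is dzeta/zeta = s dzeta_s / zeta_s. *)
Lemma slope_zeta s u : cdom (@S2_atlas R s) u -> chart_zeta s u != 0 ->
  (chart_sign R s)%:C * chart_zeta s u / zeta u *
    transition_slope s true (chart_zeta s u) = 1.
Proof.
move=> us u0; have [_ ->] := zeta_chart_zeta us u0.
move: (chart_zeta s u) u0 => w w0; rewrite /transition_slope /chart_sign.
case: s {us} => /=; first by rewrite rmorph1; field.
by rewrite rmorphN1; field.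
Qed.

(** The formula for the 1-form, solved for the potential and for the part
    along M.  The two real components along the sphere give one condition, since
    both sides are of type (1,0) there. *)
Lemma potential_formulaP (al : aidx C -> M * @S2 R -> 'rV[R[i]]_(n + 2)) c z
    (f : M * @S2 R -> R[i]) :
  cdom (C c) z -> chart_zeta c.2 z.2 != 0 ->
  al c z 0 (rshift n 1) = 'i * al c z 0 (rshift n 0) ->
  al c z = row_mx (d_M f c z *m I_zeta h c.1 z.1 (zeta z.2)) 0
           - ('i * f z / zeta z.2) *: dzeta c z <->
  f z = 'i * (chart_sign R c.2)%:C * chart_zeta c.2 z.2 *
          al c z 0 (rshift n 0) /\
  (2 * (chart_sign R c.2)%:C * chart_zeta c.2 z.2) *: lsubmx (al c z) =
    d_M f c z *m twistor_null c.1 z.1 c.2 (chart_zeta c.2 z.2).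
Proof.
move=> cz z0 ali; have [cz1 cz2] := cz; have i2 := sqr_im R.
have sl := slope_zeta cz2 z0.
have k0 : 2 * (chart_sign R c.2)%:C * chart_zeta c.2 z.2 != 0.
  by rewrite !mulf_neq0 ?two_neq0 ?chart_sign_neq0.
rewrite -(I_zetaE c.1 z.1 cz2 z0) -scalemxAr.
have dl l : dzeta c z 0 (lshift 2 l) = 0.
  by rewrite dzetaE // cD_sphere_coordl mul0r.
have d0 : dzeta c z 0 (rshift n 0) = transition_slope c.2 true (chart_zeta c.2 z.2).
  by rewrite dzetaE // cD_sphere_coord0 mul1r.
have d1 : dzeta c z 0 (rshift n 1) =
    'i * transition_slope c.2 true (chart_zeta c.2 z.2).
  by rewrite dzetaE // cD_sphere_coord1.
move: (transition_slope _ _ _) sl d0 d1 => sl slE d0 d1.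
split=> [E|[fE aE]].
  split.
    have : al c z 0 (rshift n 0) = - ('i * f z / zeta z.2 * sl).
      rewrite E [LHS]mxE row_mxEr [X in X + _]mxE add0r [LHS]mxE.
      by rewrite [X in - X]mxE d0.
    move=> ->; rewrite -[LHS]mul1r -slE.
    move: (zeta z.2)^-1 => w; ring: i2.
  congr (_ *: _); rewrite E; apply/rowP => l.
  rewrite [LHS]mxE [LHS]mxE [X in _ + X]mxE [X in _ - X]mxE dl mulr0 subr0.
  by rewrite row_mxEl.
move/(scalerI k0): aE => aE.
have bE : al c z 0 (rshift n 0) = - ('i * f z / zeta z.2 * sl).
  rewrite fE -[LHS]mul1r -slE; move: (zeta z.2)^-1 => w; ring: i2.
apply/rowP => k; rewrite [RHS]mxE [X in _ + X]mxE [X in _ - X]mxE.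
case: (split_ordP k) => [l ->|j ->].
  by rewrite dl mulr0 subr0 row_mxEl -aE mxE.
rewrite row_mxEr [X in X - _]mxE sub0r.
case: (ord2P j) => ->; first by rewrite d0.
by rewrite ali bE d1; ring.
Qed.

Lemma dbar_CP1_eq0 (f : M * @S2 R -> R[i]) c z :
  dbar_CP1 f c z = 0 <->
  cD (rshift n 0) (f \o cinv (C c)) (cmap (C c) z) +
  'i * cD (rshift n 1) (f \o cinv (C c)) (cmap (C c) z) = 0.
Proof.
rewrite /dbar_CP1 /part01 mul_proj01_CP1; split=> [E|E].
  by have := congr1 (fun X : 'cV[R[i]]_1 => X 0 0) E; rewrite !mxE.
by apply/matrixP => k l; rewrite !mxE; exact: E.
Qed.

Lemma d_ME (f : M * @S2 R -> R[i]) c z :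
  d_M f c z = der_along_M (f \o cinv (C c)) (cmap (C c) z).
Proof. by apply/rowP => l; rewrite !mxE. Qed.

Lemma potential_eqs_of_local al c z U f : form10 h al ->
  cdom (C c) z -> open U -> U z -> smooth_funC C U f ->
  (forall z, cdom (C c) z -> U z -> dbar_CP1 f c z = 0) ->
  (forall z, cdom (C c) z -> U z -> zeta_Cstar z.2 ->
     al c z = row_mx (d_M f c z *m I_zeta h c.1 z.1 (zeta z.2)) 0
              - ('i * f z / zeta z.2) *: dzeta c z) ->
  potential_eqs al c z.
Proof.
move=> hal cz oU Uz [sfr sfi] fbar fE.
have oV := @chart_image_open _ _ _ _ hM c _ oU.
have Vz : chart_image c U (cmap (C c) z) by exact: chart_image_cmap.
have sF : csmooth (chart_image c U) (f \o cinv (C c)).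
  by split; [exact: sfr|exact: sfi].
have sub y : chart_image c U y -> chart_image c setT y.
  by move=> [z' [cz' _] <-]; exact: chart_image_cmap.
have sG k : csmooth (chart_image c U) (fun y => local_rep al c y 0 k).
  exact: csmooth_sub sub (local_rep_csmooth c k hal).
have eqs y : chart_image c U y -> sphere_coord y != 0 ->
  (f \o cinv (C c)) y = 'i * (chart_sign R c.2)%:C * sphere_coord y *
     local_rep al c y 0 (rshift n 0) /\
  (2 * (chart_sign R c.2)%:C * sphere_coord y) *: lsubmx (local_rep al c y) =
    der_along_M (f \o cinv (C c)) y *m
      twistor_null c.1 (cinv (C c) y).1 c.2 (sphere_coord y).
  move=> /(chart_image_cinv hM)[cy Uy yE].
  rewrite -[in sphere_coord y]yE twistor_cmap_sphere => y0.
  have [us _] := zeta_chart_zeta cy.2 y0.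
  have [_ ali] := form10_parts hal cy.
  have := (potential_formulaP f cy y0 ali).1 (fE _ cy Uy us).
  by rewrite d_ME yE.
apply: (@potential_equations R n (chart_image c U) (local_rep al c)
  (f \o cinv (C c)) (cI1 c.1 z.1) (cI2 c.1 z.1) (cI3 c.1 z.1)
  (chart_sign R c.2)%:C (cmap (C c) z)) => //.
- exact: chart_sign_neq0.
- by move=> y Vy y0; exact: (eqs y Vy y0).1.
- move=> y /(chart_image_cinv hM)[cy Uy yE] _.
  by rewrite -yE; apply/dbar_CP1_eq0; exact: fbar.
- move=> y Vy yz y0; have [_ ->] := eqs y Vy y0.
  by have -> : z.1 = (cinv (C c) y).1 by rewrite -{1}(twistor_cmapK hM cz) /= yz.
Qed.

Lemma twistor_cover z : exists c, cdom (C c) z.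
Proof.
have [a az] : exists a, cdom (A a) z.1 by case: hM => _ _ _ cov _; exact: cov.
have [u3|u3] := boolP (sx3 z.2 != -1); first by exists (a, true).
exists (a, false); split => //=; move: u3; rewrite negbK => /eqP ->.
by rewrite -subr_eq0 -opprD oppr_eq0 -mulr2n pnatr_eq0.
Qed.

(** By [sphere_component_law] any chart around z gives the same value. *)
Definition global_potential (al : aidx C -> M * @S2 R -> 'rV[R[i]]_(n + 2)) z :
    R[i] :=
  let c := sval (cid (twistor_cover z)) in
  'i * (chart_sign R c.2)%:C * chart_zeta c.2 z.2 * al c z 0 (rshift n 0).

Lemma global_potentialE al c z : form10 h al -> cdom (C c) z ->
  global_potential al z =
  'i * (chart_sign R c.2)%:C * chart_zeta c.2 z.2 * al c z 0 (rshift n 0).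
Proof.
move=> hal cz; rewrite /global_potential; case: cid => c' /= cz'.
rewrite -!mulrA; congr (_ * _); rewrite !mulrA.
apply: (sphere_component_law hM hal.1 cz' cz).
by have [] := form10_parts hal cz.
Qed.

Lemma global_potential_rep al c y : form10 h al -> chart_image c setT y ->
  global_potential al (cinv (C c) y) =
  'i * (chart_sign R c.2)%:C * sphere_coord y * local_rep al c y 0 (rshift n 0).
Proof.
move=> hal /(chart_image_cinv hM)[cy _ yE].
by rewrite (global_potentialE hal cy) -twistor_cmap_sphere yE.
Qed.

Lemma global_potential_smooth al : form10 h al ->
  smooth_funC C setT (global_potential al).
Proof.
move=> hal.
have sF c : csmooth (chart_image c setT) (global_potential al \o cinv (C c)).
  have oV := @chart_image_open _ _ _ _ hM c _ openT.
  apply: (csmooth_eq (F := fun y => 'i * (chart_sign R c.2)%:C *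
      sphere_coord y * local_rep al c y 0 (rshift n 0)) oV) => [y Vy|].
    by rewrite -global_potential_rep.
  apply: csmoothM => //; last exact: local_rep_csmooth.
  apply: csmoothM => //; first exact: csmooth_cst.
  by split=> k; exact: Ck_on_coord.
by split=> c; [exact: (sF c).1|exact: (sF c).2].
Qed.

Lemma global_potential_der al c z : form10 h al -> cdom (C c) z ->
  cD (rshift n 0) (local_rep al c ^~ 0 ^~ (rshift n 0)) (cmap (C c) z) +
  'i * cD (rshift n 1) (local_rep al c ^~ 0 ^~ (rshift n 0)) (cmap (C c) z) = 0 ->
  dbar_CP1 (global_potential al) c z = 0 /\
  d_M (global_potential al) c z =
    ('i * (chart_sign R c.2)%:C * chart_zeta c.2 z.2) *:
      der_along_M (fun y => local_rep al c y 0 (rshift n 0)) (cmap (C c) z).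
Proof.
move=> hal cz E1.
have oV := @chart_image_open _ _ _ _ hM c _ openT.
have Vz : chart_image c setT (cmap (C c) z) by exact: chart_image_cmap.
have db : cdiff (fun y => local_rep al c y 0 (rshift n 0)) (cmap (C c) z).
  exact: csmooth_cdiff (local_rep_csmooth _ _ hal) Vz.
have nF : \forall y \near cmap (C c) z,
    (global_potential al \o cinv (C c)) y = 'i * (chart_sign R c.2)%:C *
      sphere_coord y * local_rep al c y 0 (rshift n 0).
  apply: filterS (open_nbhs_nbhs (conj oV Vz)) => y Vy.
  exact: global_potential_rep.
split.
  apply/dbar_CP1_eq0; rewrite !(cD_near _ nF) dbar_coord_mul // E1 mulr0.
  by [].
rewrite d_ME -twistor_cmap_sphere -der_along_M_coord_mul //.
by apply/rowP => l; rewrite !mxE (cD_near _ nF).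
Qed.

Lemma global_potential_formula al c z : form10 h al -> cdom (C c) z ->
  potential_eqs al c z -> zeta_Cstar z.2 ->
  al c z = row_mx (d_M (global_potential al) c z *m
                     I_zeta h c.1 z.1 (zeta z.2)) 0
           - ('i * global_potential al z / zeta z.2) *: dzeta c z.
Proof.
move=> hal cz [E1 E2 _] z0; have [cz1 cz2] := cz.
have u0 := zeta_Cstar_chart cz2 z0.
have [_ ali] := form10_parts hal cz.
apply/(potential_formulaP _ cz u0 ali); split; first exact: global_potentialE.
have [_ ->] := global_potential_der hal cz E1.
have E : lsubmx (local_rep al c (cmap (C c) z)) = lsubmx (al c z).
  by rewrite /local_rep twistor_cmapK.
rewrite -E -scalemxAl [2 * _]mulrC mulrAC -scalerA E2 scalerA.
by rewrite twistor_cmap_sphere; congr (_ *: _); rewrite mulrC mulrA.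
Qed.

End Potential.

(** * The equivalence *)

Theorem lemma4 (R : realType) (m : nat) (M : topologicalType)
    (A : atlas R M (4 * m)) (hM : smooth_manifold A) (h : hyperkahler A)
    (al : aidx (twistor_atlas A) -> M * @S2 R -> 'rV[complex R]_(4 * m + 2))
    (hal : form10 h al) :
  fiber_form11 h (dbar h al)
  <->
  (forall z0 : M * @S2 R,
    exists (U : set (M * @S2 R)) (f : M * @S2 R -> complex R),
      [/\ open U,
          U z0,
          smooth_funC (twistor_atlas A) U f,
          (forall a z, cdom (twistor_atlas A a) z -> U z ->
             dbar_CP1 f a z = 0) &
          (forall a z, cdom (twistor_atlas A a) z -> U z -> zeta_Cstar z.2 ->
             al a z = row_mx (d_M f a z *m I_zeta h a.1 z.1 (zeta z.2)) 0
                      - ('i%C * f z / zeta z.2) *: dzeta a z)]).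
Proof.
split=> [fib z0|loc c z cz].
  have eqs c z (cz : cdom (twistor_atlas A c) z) : potential_eqs h al c z.
    by apply/(fiber_form11_potential_eqs hM hal cz); exact: fib.
  exists setT, (global_potential hM al); split.
  - exact: openT.
  - by [].
  - exact: (global_potential_smooth hM hal).
  - move=> c z cz _; have [E1 _ _] := eqs c z cz.
    by have [] := global_potential_der hM hal cz E1.
  - by move=> c z cz _ zC; apply: global_potential_formula => //; exact: eqs.
apply/(fiber_form11_potential_eqs hM hal cz).
have [U [f [oU Uz sf fbar fE]]] := loc z.
apply: (potential_eqs_of_local hM hal cz oU Uz sf).
  by move=> z'; exact: fbar.
by move=> z'; exact: fE.
Qed.
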